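(* Let $R$ be a commutative ring of characteristic $2$ and $n\ge 0$. Then $\lambda:\widetilde H_n\otimes_R A\to H_n$ is an isomorphism of graded $R$-algebras, where $\widetilde H_n\otimes_R A$ carries the tensor product algebra structure. In particular $H_n\cong\widetilde H_n[x]/(x^2)$ as algebras.
   Context: Fix a commutative ring $R$. Place $2n$ points on a vertical line; $\mathfrak{C}_n$ is the set of planar crossingless matchings of these $2n$ points by $n$ disjoint arcs in one half-plane. For $a\in\mathfrak{C}_n$, $a^!$ is the reflection of $a$ across the vertical line, and $a^!b$ is the disjoint union of planar circles obtained by gluing $a^!$ and $b$ along the $2n$ points. Let $A=R[x]/(x^2)$ with comultiplication $\Delta(1)=1\otimes x+x\otimes 1$, $\Delta(x)=x\otimes x$; $\deg 1=1$, $\deg x=-1$. The arc algebra is $H_n=\bigoplus_{a,b\in\mathfrak{C}_n}A^{\otimes\pi_0(a^!b)}$ ($H_0=R$) with standard basis the pairs $(a^!b,\mathbf{v})$, $\mathbf{v}:\pi_0(a^!b)\to\{1,x\}$, of quantum degree $\#_1\mathbf{v}-\#_x\mathbf{v}-n$; its product is given by Khovanov's TQFT ($m$ for merges, $\Delta$ for splits) applied to the minimal saddle cobordism $a^!b\sqcup b^!c\to a^!c$, and products $(a^!b,\mathbf{v})(c^!d,\mathbf{v}')$ with $b\ne c$ vanish. The bottom-most point is marked; $\kappa_0$ denotes the component of $a^!b$ containing it and $\pi_*(a^!b)=\pi_0(a^!b)\setminus\{\kappa_0\}$. The reduced arc algebra $\widetilde H_n=H_n/I_x$ ($I_x$ the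 ideal spanned by basis elements with $\kappa_0$ labeled $x$) has basis $(a^!b,\mathbf{v})$ with $\mathbf{v}:\pi_*(a^!b)\to\{1,x\}$ (marked component implicitly labeled $1$), of degree $\#_1\mathbf{v}-\#_x\mathbf{v}-n-1$ (counting $\kappa_0$). For such $(a^!b,\mathbf{v})$ and $s\in\{1,x\}$, $(a^!b,\mathbf{v})_s\in H_n$ is the basis element extending $\mathbf{v}$ by $\mathbf{v}(\kappa_0)=s$; $\mathfrak{X}(a^!b,\mathbf{v})=\{\kappa\in\pi_*(a^!b):\mathbf{v}(\kappa)=x\}$; for $\kappa\in\mathfrak{X}(a^!b,\mathbf{v})$, $(a^!b,\mathbf{v}_\kappa)\in H_n$ labels $\kappa_0$ by $x$, $\kappa$ by $1$, and all other components as $\mathbf{v}$. The $R$-linear map $\lambda:\widetilde H_n\otimes_R A\to H_n$ is defined by $\lambda((a^!b,\mathbf{v})\otimes x)=(a^!b,\mathbf{v})_x$ and $\lambda((a^!b,\mathbf{v})\otimes 1)=(a^!b,\mathbf{v})_1+\sum_{\kappa\in\mathfrak{X}(a^!b,\mathbf{v})}(a^!b,\mathbf{v}_\kappa)$.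
   Formalization: Proved for n ≥ 1 instead of n ≥ 0: for n = 0 there is no marked point, and H_0 = R has rank 1, so it cannot be isomorphic to any H̃_0 ⊗ A. The immediate consequence H_n ≅ H̃_n[x]/(x²) is not stated separately. *)

(* Defs.v *)
From mathcomp Require Import all_boot all_order all_algebra.
Import GRing.Theory.
Set Implicit Arguments.
Unset Strict Implicit.
Local Open Scope ring_scope.

(* The 2n points on the vertical line are 'I_(n.*2), numbered bottom to top;
   the marked (bottom-most) point is the one with value 0. *)
Definition pt (n : nat) := 'I_(n.*2).

Definition is_cm (n : nat) (f : {ffun pt n -> pt n}) : bool :=
  [forall i : pt n, (f (f i) == i) && (f i != i)] &&
  [forall i : pt n, forall j : pt n, ~~ [&& (i < j)%N, (j < f i)%N & (f i < f j)%N]].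

Definition cm (n : nat) := {f : {ffun pt n -> pt n} | is_cm f}.

Definition arel (n : nat) (a b : cm n) : rel (pt n) :=
  fun x y => (y == val a x) || (y == val b x).

(* pi_0(a^! b): components, as sets of the points they pass through *)
Definition comps (n : nat) (a b : cm n) : {set {set pt n}} :=
  [set [set y | connect (arel a b) x y] | x : pt n].

Definition kappa0 (n : nat) (a b : cm n) : {set pt n} :=
  \bigcup_(i : pt n | val i == 0%N) [set y | connect (arel a b) i y].

(* raw triples (a, b, S): S = set of components labelled x *)
Definition trip (n : nat) := (cm n * cm n * {set {set pt n}})%type.

(* standard basis of H_n: (a^! b, v), v encoded by the set of x-labelled circles *)
Definition hb (n : nat) :=
  {t : trip n | t.2 \subset comps t.1.1 t.1.2}.
(* standard basis of the reduced algebra: kappa_0 implicitly labelled 1 *)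
Definition rb (n : nat) :=
  {t : trip n | t.2 \subset comps t.1.1 t.1.2 :\ kappa0 t.1.1 t.1.2}.
(* basis of  H~_n (x)_R A : (basis element, s) with s = true meaning x, false meaning 1 *)
Definition tb (n : nat) := (rb n * bool)%type.

Definition hdeg (n : nat) (h : hb n) : int :=
  (#|comps (val h).1.1 (val h).1.2|%:Z - (2 * #|(val h).2|)%:Z - n%:Z)%R.
Definition rdeg (n : nat) (r : rb n) : int :=
  (#|comps (val r).1.1 (val r).1.2|%:Z - (2 * #|(val r).2|)%:Z - n%:Z - 1)%R.
Definition tdeg (n : nat) (p : tb n) : int :=
  (rdeg p.1 + (if p.2 then -1 else 1))%R.

Section Algebra.
Variables (R : comNzRingType) (n : nat).

Local Notation P := (pt n).
Local Notation V2 := (P * bool)%type.   (* false: copy of a^!b, true: copy of b^!c *)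
Local Notation state := {ffun {set {set V2}} -> R^o}.

Definition delta {T : finType} (t : T) : {ffun T -> R^o} := [ffun t' => (t' == t)%:R].

(* The intermediate 1-manifold of the minimal saddle cobordism a^!b |_| b^!c -> a^!c
   after the saddles at the arcs of b with endpoints in T have been performed. *)
Definition edgeT (a b c : cm n) (T : {set P}) : rel V2 :=
  fun u v =>
    let i := u.1 in
    if u.2 then
      (v == (val c i, true)) ||
      (if i \in T then v == (i, false) else v == (val b i, true))
    else
      (v == (val a i, false)) ||
      (if i \in T then v == (i, true) else v == (val b i, false)).

Definition compsT (a b c : cm n) (T : {set P}) : {set {set V2}} :=
  [set [set v | connect (edgeT a b c T) u v] | u : V2].

(* Khovanov's TQFT applied to the saddle at the arc {i, b i}: m for merges,
   Delta for splits (Delta(1) = 1(x)x + x(x)1, Delta(x) = x(x)x). *)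
Definition saddle (a b c : cm n) (T : {set P}) (i : P) (S : {set {set V2}}) : state :=
  let Pc := compsT a b c T in
  let Qc := compsT a b c (i |: (val b i |: T)) in
  let CL := pblock Pc (i, false) in
  let CR := pblock Pc (i, true) in
  if CL != CR then
    let D := pblock Qc (i, false) in
    let S0 := S :\ CL :\ CR in
    match ((CL \in S) + (CR \in S))%N with
    | 0 => delta S0
    | 1 => delta (D |: S0)
    | _ => 0
    end
  else
    let D1 := pblock Qc (i, false) in
    let D2 := pblock Qc (val b i, false) in
    let S0 := S :\ CL in
    if CL \in S then delta (D1 |: (D2 |: S0))
    else delta (D1 |: S0) + delta (D2 |: S0).

Definition lin_ext {T U : finType} (f : T -> {ffun U -> R^o}) (u : {ffun T -> R^o})
  : {ffun U -> R^o} := \sum_(t : T) u t *: f t.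

Definition arcs (b : cm n) : seq P := [seq i : P <- enum P | (i < val b i)%N].

Definition saddle_step (a b c : cm n) (st : {set P} * state) (i : P)
  : {set P} * state :=
  (i |: (val b i |: st.1), lin_ext (saddle a b c st.1 i) st.2).

Definition hcoef (u : {ffun hb n -> R^o}) (t : trip n) : R :=
  if @insub _ _ (hb n) t is Some h then u h else 0.
Definition rcoef (u : {ffun rb n -> R^o}) (t : trip n) : R :=
  if @insub _ _ (rb n) t is Some r then u r else 0.
Definition hdelta (t : trip n) : {ffun hb n -> R^o} := [ffun h => (val h == t)%:R].

Definition hprod_b (h1 h2 : hb n) : {ffun hb n -> R^o} :=
  let: (a, b, S1) := val h1 in
  let: (b', c, S2) := val h2 in
  if b != b' then 0 else
  let init : {set {set V2}} :=
    [set [set ((v : P), false) | v in C] | C : {set P} in S1] :|: [set [set ((v : P), true) | v in C] | C : {set P} in S2] in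
  let fin := (foldl (saddle_step a b c) (set0, delta init) (arcs b)).2 in
  let proj (Sf : {set {set V2}}) : {set {set P}} := [set [set (v : V2).1 | v in D] | D : {set V2} in Sf] in
  [ffun h => if (val h).1 == (a, c)
             then \sum_(Sf : {set {set V2}} | proj Sf == (val h).2) fin Sf
             else 0].

Definition hmul (u v : {ffun hb n -> R^o}) : {ffun hb n -> R^o} :=
  \sum_(h1 : hb n) \sum_(h2 : hb n) (u h1 * v h2) *: hprod_b h1 h2.

Definition hone : {ffun hb n -> R^o} :=
  [ffun h => (((val h).1.1 == (val h).1.2) && ((val h).2 == set0))%:R].

(* reduced arc algebra H_n / I_x: lift (kappa_0 labelled 1), multiply, reduce *)
Definition rlift (u : {ffun rb n -> R^o}) : {ffun hb n -> R^o} := [ffun h => rcoef u (val h)].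
Definition rmul (u v : {ffun rb n -> R^o}) : {ffun rb n -> R^o} :=
  [ffun r => hcoef (hmul (rlift u) (rlift v)) (val r)].
Definition rone : {ffun rb n -> R^o} :=
  [ffun r => (((val r).1.1 == (val r).1.2) && ((val r).2 == set0))%:R].

(* tensor product algebra H~_n (x)_R A, A = R[x]/(x^2) with basis 1 (false), x (true) *)
Definition tprod_b (p q : tb n) : {ffun tb n -> R^o} :=
  if p.2 && q.2 then 0 else
  let w := rmul (delta p.1) (delta q.1) in
  [ffun p' : tb n => if p'.2 == (p.2 || q.2) then w p'.1 else 0].
Definition tmul (u v : {ffun tb n -> R^o}) : {ffun tb n -> R^o} :=
  \sum_(p : tb n) \sum_(q : tb n) (u p * v q) *: tprod_b p q.
Definition tone : {ffun tb n -> R^o} := [ffun p => (~~ p.2)%:R * rone p.1].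

Definition lam_b (p : tb n) : {ffun hb n -> R^o} :=
  let: (a, b, Sx) := val p.1 in
  let k0 := kappa0 a b in
  if p.2 then hdelta (a, b, k0 |: Sx)
  else hdelta (a, b, Sx) + \sum_(k in Sx) hdelta (a, b, k0 |: (Sx :\ k)).
Definition lam (u : {ffun tb n -> R^o}) : {ffun hb n -> R^o} := lin_ext lam_b u.

End Algebra.

(* Main.v *)
Require Import Defs.
From HB Require Import structures.
From mathcomp Require Import all_boot all_order all_algebra all_fingroup zify.
Import GRing.Theory.
Set Implicit Arguments.
Unset Strict Implicit.
Local Open Scope ring_scope.

(** Let nu be the operator on labelled circles summing all ways of relabelling one
    circle from x to 1, and X the multiplication by x at the marked circle. In
    characteristic 2, nu commutes with merges and splits, hence is a derivation of
    H_n; X is H_n-linear on both sides; and nu^2 = X^2 = 0, nu X + X nu = 1.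
    So H_n = ker nu (+) X (ker nu), with nu X a multiplicative projection onto
    ker nu whose kernel im X is the ideal I_x. Writing v_1 for the
    lift of v with marked circle labelled 1, lambda sends v (x) 1 to nu X v_1 and
    v (x) x to X v_1.

    Commutation with a split needs the two new circles to be distinct. Matched
    points have opposite parities, so all circles of the intermediate manifolds are
    compatibly oriented and are the cycles of a permutation; a saddle multiplies
    that permutation by a transposition. *)

(** The definition of [saddle] decides between merge and split by comparing the two old circles
    only; nothing in it forces the two circles after a split to differ. If they coincided, Delta(x)
    would carry one label x instead of two, and nu would no longer commute with it. This does occur
    for crossing matchings: on four points, with arcs 12, 34 for a, 13, 24 for b and 14, 23 for c,
    the second saddle turns a single circle into a single circle. Planarity enters the proof exactly
    here, through the parity of matched points. The other delicate point is the marked circle: X is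
    attached to a point rather than to a circle, so that it can be followed through all saddles, and
    after the last one both copies of the marked point lie on one circle. That is why X can be moved
    into either factor of a product. *)

(** * Linear extension from a finite basis *)

Section LinExt.
Variables (R : comNzRingType) (T U : finType).
Implicit Types (f : T -> {ffun U -> R^o}) (u : {ffun T -> R^o}).

Lemma lin_ext_is_linear f : linear (lin_ext f).
Proof.
move=> k u v; rewrite /lin_ext scaler_sumr -big_split; apply: eq_bigr => t _ /=.
by rewrite !ffunE scalerDl scalerA.
Qed.

HB.instance Definition _ f :=
  GRing.isLinear.Build R {ffun T -> R^o} {ffun U -> R^o} *:%R (lin_ext f)
    (lin_ext_is_linear f).

Lemma lin_ext_delta f t : lin_ext f (delta R t) = f t.
Proof.
rewrite /lin_ext (bigD1 t) //= big1 ?addr0 => [|t' /negPf ne]; rewrite ffunE.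
  by rewrite eqxx scale1r.
by rewrite ne scale0r.
Qed.

Lemma eq_lin_ext f g : f =1 g -> lin_ext f =1 lin_ext g.
Proof. by move=> fg u; apply: eq_bigr => t _; rewrite fg. Qed.

Lemma delta_decomp u : u = \sum_t u t *: delta R t.
Proof.
apply/ffunP => t; rewrite sum_ffunE (bigD1 t) //= big1 ?addr0 => [|t' /negPf ne];
  rewrite !ffunE ?eqxx ?[t == t']eq_sym ?ne.
  by rewrite /GRing.scale /= mulr1.
by rewrite scaler0.
Qed.

Lemma lin_ext_eq (F G : {linear {ffun T -> R^o} -> {ffun U -> R^o}}) :
  (forall t, F (delta R t) = G (delta R t)) -> F =1 G.
Proof.
move=> eqFG u; rewrite [u]delta_decomp !linear_sum.
by apply: eq_bigr => t _; rewrite !linearZ /= eqFG.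
Qed.

End LinExt.

(** * States carried by the labellings of given circles *)

Section Supported.
Variables (R : comNzRingType) (Z : finType).
Implicit Types (u : {ffun {set Z} -> R^o}) (A : {set Z}).

(** Labels range over all sets of points, most of which are not circles of the manifold at hand. The
    saddle identities hold only on label sets made of genuine circles, so every state is accompanied
    by this condition. *)
Definition supported A u := forall S : {set Z}, u S != 0 -> S \subset A.

Lemma supported0 A : supported A 0.
Proof. by move=> S; rewrite ffunE eqxx. Qed.

Lemma supported_delta A (S : {set Z}) : S \subset A -> supported A (delta R S).
Proof. by move=> sSA S'; rewrite ffunE; case: (S' =P S) => [->|_] //; rewrite eqxx. Qed.

Lemma supportedD A u v : supported A u -> supported A v -> supported A (u + v).
Proof.
move=> su sv S; rewrite ffunE; have [u0|/su //] := eqVneq (u S) 0.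
by rewrite u0 add0r => /sv.
Qed.

Lemma supported_sum A (I : Type) (r : seq I) (P : pred I) (F : I -> {ffun {set Z} -> R^o}) :
  (forall i, P i -> supported A (F i)) -> supported A (\sum_(i <- r | P i) F i).
Proof.
by move=> sF; elim/big_ind: _ => //; [apply: supported0|move=> u v; apply: supportedD].
Qed.

Lemma supportedZ A k u : supported A u -> supported A (k *: u).
Proof.
move=> su S; rewrite ffunE; have [u0|/su //] := eqVneq (u S) 0.
by rewrite u0 scaler0 eqxx.
Qed.

Lemma supported_eq (U : finType) A u
    (F G : {linear {ffun {set Z} -> R^o} -> {ffun U -> R^o}}) :
  (forall S : {set Z}, S \subset A -> F (delta R S) = G (delta R S)) -> supported A u ->
  F u = G u.
Proof.
move=> eqFG su; rewrite [u]delta_decomp !linear_sum.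
apply: eq_bigr => S _; rewrite !linearZ; have [->|/su/eqFG -> //] := eqVneq (u S) 0.
by rewrite /= !scale0r.
Qed.

End Supported.

Lemma supported_lin_ext (R : comNzRingType) (Z Z' : finType) (A : {set Z}) (B : {set Z'})
    (f : {set Z} -> {ffun {set Z'} -> R^o}) u :
  (forall S : {set Z}, S \subset A -> supported B (f S)) -> supported A u ->
  supported B (lin_ext f u).
Proof.
move=> sf su; apply: supported_sum => S _; have [->|/su/sf sfS] := eqVneq (u S) 0.
  by rewrite scale0r; apply: supported0.
exact: supportedZ.
Qed.

(** * The operators nu and multiplication by x on labelled circles *)

Section Operators.
Variables (R : comNzRingType) (Z : finType).
Local Notation state := {ffun {set Z} -> R^o}.
Local Notation delta := (delta R).
Implicit Types (S A : {set Z}) (k : Z).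

(* On A^{(x)k}, [nu] is the sum over the circles of the derivation x |-> 1, 1 |-> 0
   of A, which exists because 2 = 0; [mulx k] multiplies by x at the circle k. *)
Definition nu_b S : state := \sum_(k in S) delta (S :\ k).
Definition mulx_b k S : state := if k \in S then 0 else delta (k |: S).
Definition nu : state -> state := lin_ext nu_b.
Definition mulx k : state -> state := lin_ext (mulx_b k).
HB.instance Definition _ := GRing.Linear.on nu.
HB.instance Definition _ k := GRing.Linear.on (mulx k).

Lemma setU1D1 k j S : k != j -> (k |: S) :\ j = k |: (S :\ j).
Proof.
move=> nkj; apply/setP => z; rewrite !inE.
by have [->|_] := eqVneq z k; rewrite ?nkj ?orbT.
Qed.

Lemma nu_b_setU1 k S : k \notin S ->
  nu_b (k |: S) = delta S + \sum_(j in S) delta (k |: (S :\ j)).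
Proof.
move=> kS; rewrite /nu_b (big_setD1 k) ?setU11 //= setU1K //; congr (_ + _).
by apply: eq_bigr => j jS; rewrite setU1D1 //; apply: contraNneq kS => ->.
Qed.

Lemma nu_delta S : nu (delta S) = nu_b S. Proof. exact: lin_ext_delta. Qed.
Lemma mulx_delta k S : mulx k (delta S) = mulx_b k S. Proof. exact: lin_ext_delta. Qed.

Lemma supported_nu A u : supported A u -> supported A (nu u).
Proof.
apply: supported_lin_ext => S sSA; apply: supported_sum => k _.
by apply: supported_delta; apply: subset_trans sSA; apply: subsetDl.
Qed.

Lemma supported_mulx A k u : k \in A -> supported A u -> supported A (mulx k u).
Proof.
move=> kA; apply: supported_lin_ext => S sSA; rewrite /mulx_b.
case: ifP => _; first exact: supported0.
by apply: supported_delta; rewrite subUset sub1set kA.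
Qed.

Lemma mulx_mulx k u : mulx k (mulx k u) = 0.
Proof.
apply: (lin_ext_eq (F := mulx k \o mulx k) (G := \0)) => S /=; rewrite mulx_delta /mulx_b.
by case: ifP => kS; rewrite ?linear0 // mulx_delta /mulx_b setU11.
Qed.

Hypothesis char2 : 2%N \in [pchar R].

Lemma lmod_addrr (U : lmodType R) (x : U) : x + x = 0.
Proof. by rewrite -mulr2n -scaler_nat (pcharf0 char2) scale0r. Qed.

(** The summand of nu at [k] gives the identity, as the derivation x |-> 1 of A anticommutes with x
    up to 1. The summands at the other circles commute with [mulx k], hence occur twice and
    cancel. *)
Lemma nu_mulx k u : nu (mulx k u) + mulx k (nu u) = u.
Proof.
apply: (lin_ext_eq (F := (nu \o mulx k) \+ (mulx k \o nu)) (G := idfun)) => S /=.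
rewrite mulx_delta nu_delta /mulx_b; case: ifP => kS.
  rewrite linear0 add0r -{1}(setD1K kS) nu_b_setU1 ?setD11 // linearD /= mulx_delta.
  rewrite /mulx_b setD11 setD1K // linear_sum big1 ?addr0 // => j _.
  by rewrite /= mulx_delta /mulx_b setU11.
rewrite nu_delta nu_b_setU1 ?kS // [nu_b S]/nu_b linear_sum -addrA -big_split big1 ?addr0 //.
move=> j jS /=; rewrite mulx_delta /mulx_b.
by rewrite !inE kS andbF lmod_addrr.
Qed.

Lemma nu_nu u : nu (nu u) = 0.
Proof.
apply: (lin_ext_eq (F := nu \o nu) (G := \0)) => /= S.
have [m] := ubnP #|S|; elim: m => // m IH in S *; rewrite ltnS => leSm.
have [->|[k kS]] := set_0Vmem S; first by rewrite nu_delta /nu_b big_set0 linear0.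
(* By [nu_mulx], the square of nu commutes with [mulx k]; every basis state arises from the all-1
   state by such multiplications. *)
have step w : nu (nu (mulx k w)) = mulx k (nu (nu w)).
  have nux z : nu (mulx k z) = z - mulx k (nu z) by rewrite -{2}(nu_mulx k z) addrK.
  by rewrite nux linearB /= nux opprB addrCA subrr addr0.
have eS : delta S = mulx k (delta (S :\ k)) by rewrite mulx_delta /mulx_b setD11 setD1K.
rewrite eS step IH ?linear0 //.
by apply: leq_trans leSm; rewrite [X in (_ < X)%N](cardsD1 k) kS.
Qed.

End Operators.

(** * Merge and split on labels, and their commutation with nu and X *)

Section MergeSplit.
Variables (R : comNzRingType) (Z : finType).
Local Notation state := {ffun {set Z} -> R^o}.
Local Notation delta := (delta R).
Implicit Types (S A : {set Z}) (k C D : Z).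
Hypothesis char2 : 2%N \in [pchar R].

(** This and [split_b] are the two branches of [saddle] with the circles made arbitrary elements,
    which separates the identities on labels from the topology. *)
Definition merge_b C C' D S : state :=
  let S0 := S :\ C :\ C' in
  match ((C \in S) + (C' \in S))%N with
  | 0 => delta S0
  | 1 => delta (D |: S0)
  | _ => 0
  end.

Definition split_b C D D' S : state :=
  let S0 := S :\ C in
  if C \in S then delta (D |: (D' |: S0)) else delta (D |: S0) + delta (D' |: S0).

Lemma setD1_notin k S : k \notin S -> S :\ k = S.
Proof. by move=> kS; apply/setDidPl; rewrite disjoint_sym disjoints1. Qed.

Section Merge.
Variables (C C' D : Z) (S : {set Z}).
Hypotheses (neC : C != C') (CS : C \notin S) (C'S : C' \notin S).

Lemma merge0 : merge_b C C' D S = delta S.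
Proof. by rewrite /merge_b (negPf CS) (negPf C'S) !setD1_notin. Qed.

Lemma mergel : merge_b C C' D (C |: S) = delta (D |: S).
Proof.
by rewrite /merge_b !inE eqxx eq_sym (negPf neC) (negPf C'S) /= setU1K // setD1_notin.
Qed.

Lemma merger : merge_b C C' D (C' |: S) = delta (D |: S).
Proof.
rewrite /merge_b !inE eqxx (negPf neC) (negPf CS) /= setU1D1 1?eq_sym //.
by rewrite [S :\ C]setD1_notin // setU1K.
Qed.

Lemma mergelr : merge_b C C' D (C |: (C' |: S)) = 0.
Proof. by rewrite /merge_b !inE !eqxx orbT. Qed.

End Merge.

Section Split.
Variables (C D D' : Z) (S : {set Z}).
Hypotheses (CS : C \notin S).

Lemma split0 : split_b C D D' S = delta (D |: S) + delta (D' |: S).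
Proof. by rewrite /split_b (negPf CS) setD1_notin. Qed.

Lemma split1 : split_b C D D' (C |: S) = delta (D |: (D' |: S)).
Proof. by rewrite /split_b setU11 setU1K. Qed.

End Split.

Lemma setD2_cases C C' S : C != C' ->
  let S0 := S :\ C :\ C' in
  [/\ C \notin S0, C' \notin S0 &
   [\/ S = S0, S = C |: S0, S = C' |: S0 | S = C |: (C' |: S0)]].
Proof.
move=> neC S0; rewrite /S0 !inE !eqxx /= andbF; split=> //.
have [CS|CS] := boolP (C \in S); have [C'S|C'S] := boolP (C' \in S).
- by constructor 4; rewrite setD1K ?setD1K // !inE eq_sym neC.
- by constructor 2; rewrite [_ :\ C']setD1_notin ?setD1K // !inE negb_and C'S orbT.
- by constructor 3; rewrite [S :\ C]setD1_notin ?setD1K.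
- by constructor 1; rewrite [S :\ C]setD1_notin // setD1_notin.
Qed.

Lemma nu_b_setU2 k k' S : k != k' -> k \notin S -> k' \notin S ->
  nu_b R (k |: (k' |: S)) =
  delta (k' |: S) + delta (k |: S) + \sum_(j in S) delta (k |: (k' |: (S :\ j))).
Proof.
move=> nkk kS k'S; rewrite nu_b_setU1 ?in_setU1 ?negb_or ?nkk // -addrA; congr (_ + _).
rewrite (big_setD1 k') ?setU11 //= setU1K //; congr (_ + _).
apply: eq_bigr => j jS; rewrite setU1D1 //; apply: contraNneq k'S => -> //.
Qed.

Lemma notinD1 k S j : k \notin S -> k \notin S :\ j.
Proof. by rewrite !inE negb_and orbC => ->. Qed.

(** Characteristic 2 is used on x (x) x: merging gives 0, while nu followed by the merge gives 2x.
    In the other cases the terms agree one by one. *)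
Lemma merge_nu C C' D S : C != C' -> D \notin S :\ C :\ C' ->
  nu (merge_b C C' D S) = lin_ext (merge_b C C' D) (nu_b R S).
Proof.
move=> neC; have [] := setD2_cases S neC.
move: (S :\ C :\ C') => S0 CS C'S eS DS.
have nD := notinD1.
case: eS => ->.
- rewrite merge0 // nu_delta linear_sum; apply: eq_bigr => j jS /=.
  by rewrite lin_ext_delta merge0 ?nD.
- rewrite mergel // nu_delta !nu_b_setU1 // linearD linear_sum /= lin_ext_delta merge0 //.
  by congr (_ + _); apply: eq_bigr => j jS /=; rewrite lin_ext_delta mergel ?nD.
- rewrite merger // nu_delta !nu_b_setU1 // linearD linear_sum /= lin_ext_delta merge0 //.
  by congr (_ + _); apply: eq_bigr => j jS /=; rewrite lin_ext_delta merger ?nD.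
rewrite mergelr // linear0 nu_b_setU2 // !linearD linear_sum /= !lin_ext_delta.
rewrite mergel // merger // lmod_addrr // big1 ?addr0 // => j jS.
by rewrite lin_ext_delta mergelr ?nD.
Qed.

(** On x: nu(x (x) x) = 1 (x) x + x (x) 1 = Delta(1), which takes two distinct new circles. On 1:
    nu(Delta(1)) is twice 1 (x) 1, hence 0. *)
Lemma split_nu C D D' S : D != D' -> D \notin S :\ C -> D' \notin S :\ C ->
  nu (split_b C D D' S) = lin_ext (split_b C D D') (nu_b R S).
Proof.
move=> neD; have nD := notinD1.
have [CS|CS] := boolP (C \in S).
  rewrite -{3}(setD1K CS); have := setD11 C S; move: (S :\ C) (setD1K CS) => S0 <-.
  move=> /negbT CS0 DS D'S.
  rewrite split1 // nu_delta nu_b_setU2 // nu_b_setU1 // linearD linear_sum /=.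
  rewrite lin_ext_delta split0 // [delta (D' |: _) + _]addrC; congr (_ + _).
  by apply: eq_bigr => j jS; rewrite lin_ext_delta split1 ?nD.
rewrite setD1_notin // => DS D'S.
rewrite split0 // linearD /= !nu_delta !nu_b_setU1 // addrACA lmod_addrr // add0r -big_split.
by rewrite linear_sum; apply: eq_bigr => j jS /=; rewrite lin_ext_delta split0 ?nD.
Qed.

Lemma mulx_b_in k S : k \in S -> mulx_b R k S = 0. Proof. by rewrite /mulx_b => ->. Qed.
Lemma mulx_b_notin k S : k \notin S -> mulx_b R k S = delta (k |: S).
Proof. by rewrite /mulx_b => /negPf->. Qed.

(** The product of A is A-linear in each factor. Here [k'] is what [k] becomes: [D] if [k] is one of
    the merged circles, [k] itself otherwise. *)
Lemma merge_mulx C C' D k k' S : C != C' -> D \notin S :\ C :\ C' ->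
  (if (k == C) || (k == C') then k' = D else k' = k /\ k != D) ->
  mulx k' (merge_b C C' D S) = lin_ext (merge_b C C' D) (mulx_b R k S).
Proof.
move=> neC; have [] := setD2_cases S neC.
move: (S :\ C :\ C') => S0 CS C'S eS DS.
have neC' : C' != C by rewrite eq_sym.
case: eqVneq => [->{k} ->{k'}|nkC].
  case: eS => ->.
  - by rewrite merge0 // mulx_delta !mulx_b_notin // lin_ext_delta mergel.
  - by rewrite mergel // mulx_delta !mulx_b_in ?setU11 // linear0.
  - by rewrite merger // mulx_delta mulx_b_in ?setU11 // mulx_b_notin ?inE ?negb_or ?neC //
      lin_ext_delta mergelr.
  - by rewrite mergelr // linear0 mulx_b_in ?setU11 // linear0.
case: eqVneq => [->{k nkC} ->{k'}|nkC' /= [->{k'} nkD]].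
  case: eS => ->.
  - by rewrite merge0 // mulx_delta !mulx_b_notin // lin_ext_delta merger.
  - by rewrite mergel // mulx_delta mulx_b_in ?setU11 // mulx_b_notin ?inE ?negb_or ?neC' //
      setUCA lin_ext_delta mergelr.
  - by rewrite merger // mulx_delta !mulx_b_in ?setU11 // linear0.
  - by rewrite mergelr // linear0 mulx_b_in ?inE ?eqxx ?orbT // linear0.
have nU (T : {set Z}) j : k \notin T -> k != j -> k \notin j |: T by rewrite !inE negb_or => -> ->.
have iU (T : {set Z}) j : k \in T -> k \in j |: T by rewrite !inE orbC => ->.
have kN j (T : {set Z}) : j != k -> j \notin T -> j \notin k |: T.
  by rewrite !inE negb_or => -> ->.
have [nCk nC'k] : C != k /\ C' != k by rewrite ![_ == k]eq_sym.
have [kS|kS] := boolP (k \in S0).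
  by case: eS => ->; [rewrite merge0|rewrite mergel|rewrite merger|rewrite mergelr];
    rewrite // ?mulx_delta !mulx_b_in ?linear0 ?iU.
case: eS => ->.
- by rewrite merge0 // mulx_delta !mulx_b_notin // lin_ext_delta merge0 ?kN.
- rewrite mergel // mulx_delta !mulx_b_notin ?nU // ![k |: (_ |: S0)]setUCA.
  by rewrite lin_ext_delta mergel ?kN.
- rewrite merger // mulx_delta !mulx_b_notin ?nU // ![k |: (_ |: S0)]setUCA.
  by rewrite lin_ext_delta merger ?kN.
- rewrite mergelr // linear0 !mulx_b_notin ?nU // setUCA [k |: (_ |: S0)]setUCA.
  by rewrite lin_ext_delta mergelr ?kN.
Qed.

(** Delta is a map of A-bimodules, so a multiplication by x at [C] may be carried out at either of
    the new circles. *)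
Lemma split_mulx C D D' k k' S : D != D' -> D \notin S :\ C -> D' \notin S :\ C ->
  (if k == C then k' = D \/ k' = D' else [/\ k' = k, k != D & k != D']) ->
  mulx k' (split_b C D D' S) = lin_ext (split_b C D D') (mulx_b R k S).
Proof.
move=> neD; have neD' : D' != D by rewrite eq_sym.
have [CS|CS] := boolP (C \in S).
  rewrite -{4}(setD1K CS) -{3}(setD1K CS).
  have := setD11 C S; move: (S :\ C) => S0 /negbT CS0 DS D'S.
  rewrite split1 // mulx_delta; case: eqVneq => [->{k} k'D|nkC [->{k'} nkD nkD']].
    by rewrite !mulx_b_in ?setU11 ?linear0 //; case: k'D => ->; rewrite !inE eqxx ?orbT.
  have [kS|kS] := boolP (k \in S0); first by rewrite !mulx_b_in ?linear0 // !inE kS ?orbT.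
  rewrite !mulx_b_notin ?inE ?negb_or ?nkC ?nkD ?nkD' //.
  rewrite [k |: (C |: _)]setUCA lin_ext_delta split1; last by rewrite !inE negb_or eq_sym nkC.
  by rewrite setUCA [k |: (D' |: _)]setUCA.
rewrite setD1_notin // => DS D'S.
rewrite split0 // linearD /= !mulx_delta; case: eqVneq => [->{k} k'D|nkC [->{k'} nkD nkD']].
  rewrite [mulx_b _ C _]mulx_b_notin // lin_ext_delta split1 //.
  case: k'D => ->.
    by rewrite mulx_b_in ?setU11 // add0r mulx_b_notin // !inE negb_or neD.
  by rewrite [mulx_b _ _ (D' |: _)]mulx_b_in ?setU11 // addr0 mulx_b_notin 1?setUCA // !inE negb_or neD'.
have [kS|kS] := boolP (k \in S); first by rewrite !mulx_b_in ?linear0 ?addr0 // !inE kS ?orbT.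
rewrite !mulx_b_notin ?inE ?negb_or ?nkC ?nkD ?nkD' //.
rewrite lin_ext_delta split0; last by rewrite !inE negb_or eq_sym nkC.
by rewrite ![k |: (_ |: _)]setUCA.
Qed.

Lemma supported_merge A C C' D S : S :\ C :\ C' \subset A -> D \in A ->
  supported A (merge_b C C' D S).
Proof.
move=> SA DA; rewrite /merge_b; case: addn => [|[|_]].
- exact: supported_delta.
- by apply: supported_delta; rewrite subUset sub1set DA.
- exact: supported0.
Qed.

Lemma supported_split A C D D' S : S :\ C \subset A -> D \in A -> D' \in A ->
  supported A (split_b C D D' S).
Proof.
move=> SA DA D'A; rewrite /split_b; case: ifP => _.
  by apply: supported_delta; rewrite !subUset !sub1set DA D'A.
by apply: supportedD; apply: supported_delta; rewrite subUset sub1set ?DA ?D'A.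
Qed.

End MergeSplit.

(** * Crossingless matchings and parity *)

Section Matching.
Variable n : nat.
Implicit Types (a b : cm n) (i j : pt n).

Lemma cmK a : involutive (val a).
Proof. by move=> i; have /andP[/forallP/(_ i)/andP[/eqP]] := valP a. Qed.

Lemma cm_neq a i : val a i != i.
Proof. by have /andP[/forallP/(_ i)/andP[]] := valP a. Qed.

Lemma cm_inj a : injective (val a). Proof. exact: can_inj (cmK a). Qed.

Lemma cm_crossingless a i j : (i < j)%N -> (j < val a i)%N -> (val a j < val a i)%N.
Proof.
move=> ij jai; have /andP[_ /forallP/(_ i)/forallP/(_ j)] := valP a.
rewrite ij jai /= -leqNgt leq_eqVlt => /orP[/eqP/val_inj/cm_inj ji|//].
by rewrite ji ltnn in ij.
Qed.

(** The relation [r] selects one element of each pair [x], [f x], and [f] exchanges the selected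
    half of [A] with the rest. *)
Lemma even_involution_card (T : finType) (f : T -> T) (r : rel T) (A : {set T}) :
    involutive f -> (forall x, x \in A -> f x \in A) ->
    (forall x, r (f x) x = ~~ r x (f x)) -> ~~ odd #|A|.
Proof.
move=> fK Af rf; rewrite -(cardsID [set x | r x (f x)] A).
suff -> : A :\: [set x | r x (f x)] = f @: (A :&: [set x | r x (f x)]).
  by rewrite card_imset ?oddD ?addbb //; apply: can_inj fK.
apply/setP => x; rewrite -{2}[x]fK (mem_imset _ _ (can_inj fK)) !inE fK.
by rewrite rf andbC; congr (_ && _); apply/idP/idP => /Af; rewrite ?fK.
Qed.

(* The points strictly below an arc are matched among themselves. *)
Lemma cm_odd_lt a i : (i < val a i)%N -> odd (val a i) = ~~ odd i.
Proof.
move=> lti; pose A := [set j : pt n | (i < j < val a i)%N].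
have evA : ~~ odd #|A|.
  apply: (@even_involution_card _ (val a) (fun x y => (x < y)%N)) => [|j|j]; first exact: cmK.
    rewrite !inE => /andP[ij ja]; rewrite cm_crossingless // andbT ltnNge leq_eqVlt.
    apply/negP=> /orP[/eqP/val_inj eij|ji].
      by rewrite -eij cmK ltnn in ja.
    have := @cm_crossingless a (val a j) i ji; rewrite cmK => /(_ ij).
    by rewrite ltnNge ltnW.
  by rewrite -leqNgt [RHS]leq_eqVlt -[nat_of_ord _ == _ in RHS]/(val a j == j) (negPf (cm_neq _ _)).
have cA : #|A| = (val a i - i.+1)%N.
  rewrite -(size_iota i.+1 (val a i - i.+1)) cardE -(size_map val); apply/perm_size.
  apply: uniq_perm; rewrite ?iota_uniq ?map_inj_uniq ?enum_uniq //; first exact: val_inj.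
  move=> k; rewrite mem_iota subnKC //; apply/mapP/idP => [[j]|/andP[ik ka]].
    by rewrite mem_enum inE => ? ->.
  have kn : (k < n.*2)%N by exact: ltn_trans ka (ltn_ord _).
  by exists (Ordinal kn) => //; rewrite mem_enum inE /= ik.
by move: evA; rewrite cA oddB //= negb_add => /eqP.
Qed.

Lemma cm_odd a i : odd (val a i) = ~~ odd i.
Proof.
have := cm_neq a i; rewrite -[_ == i]/(val (val a i) == val i) neq_ltn.
case/orP => [lt|/cm_odd_lt//].
by rewrite -(negbK (odd (val a i))) -(@cm_odd_lt a (val a i)) cmK.
Qed.

End Matching.

(** * Components of a relation *)

Section Connect.
Variables (V : finType).
Implicit Types (e : rel V).

(** Avoidance is asked of [e] only: a path of [e'] from [v] is converted edge by edge, each vertex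
    reached being [e]-connected to [v] and hence outside [F]. *)
Lemma connect_agree e e' (F : pred V) v :
  (forall u, ~~ F u -> e u =1 e' u) -> (forall w, connect e v w -> ~~ F w) ->
  connect e v =1 connect e' v.
Proof.
move=> agr avoid w; apply/idP/idP => /connectP[p].
  elim/last_ind: p w => [|p y IHp] w; first by move=> _ ->; apply: connect0.
  rewrite rcons_path last_rcons => /andP[pp ey] ->.
  apply: connect_trans (IHp _ pp erefl) (connect1 _).
  by rewrite -agr //; apply: avoid; apply/connectP; exists p.
elim/last_ind: p w => [|p y IHp] w; first by move=> _ ->; apply: connect0.
rewrite rcons_path last_rcons => /andP[pp ey] ->.
have cp := IHp _ pp erefl; apply: connect_trans (cp) (connect1 _).
by rewrite agr //; apply: avoid cp.
Qed.

Definition cclass e v := [set w | connect e v w].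

Section Sym.
Variables (e : rel V).
Hypothesis sym_e : symmetric e.

Lemma cclass_eq v w : (cclass e v == cclass e w) = connect e v w.
Proof.
have sc : connect_sym e by apply: sym_connect_sym.
apply/eqP/idP => [/setP/(_ w)|cvw]; first by rewrite !inE connect0 => ->.
by apply/setP => z; rewrite !inE (same_connect sc cvw).
Qed.

Lemma mem_cclass v w : (w \in cclass e v) = (cclass e v == cclass e w).
Proof. by rewrite inE cclass_eq. Qed.

Lemma cclass_id v : v \in cclass e v. Proof. by rewrite inE connect0. Qed.

Lemma trivIset_cclass : trivIset [set cclass e v | v : V].
Proof.
apply/trivIsetP => _ _ /imsetP[v _ ->] /imsetP[w _ ->]; apply: contraR.
rewrite -setI_eq0 => /set0Pn[z]; rewrite inE !mem_cclass => /andP[/eqP-> /eqP->] //.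
Qed.

Lemma pblock_cclass v : pblock [set cclass e v | v : V] v = cclass e v.
Proof.
by apply: def_pblock trivIset_cclass (imset_f _ _) (cclass_id _).
Qed.

End Sym.
End Connect.

(** A transposition changes the number of cycles by one, and the direction tells whether [x] and [y]
    shared a cycle. Counting for [s] and for the product, each obtained from the other by the same
    transposition, forces opposite answers. *)
Lemma porbit_mul_tperm (T : finType) (s : {perm T}) x y : x != y ->
  (x \in porbit (tperm x y * s)%g y) = (x \notin porbit s y).
Proof.
move=> nxy; have := porbits_mul_tperm s x y; have := porbits_mul_tperm (tperm x y * s)%g x y.
rewrite /= mulgA tperm2 mul1g nxy.
by case: (x \in porbit _ y); case: (x \in porbit s y) => //=; lia.
Qed.

(** * Circles of the intermediate manifolds *)

Section Cobordism.
Variables (n : nat) (a b c : cm n).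
Local Notation P := (pt n).
Local Notation V2 := (P * bool)%type.
Implicit Types (T : {set P}) (u v : V2).

Definition outer u : V2 := (if u.2 then val c u.1 else val a u.1, u.2).
Definition inner T u : V2 := if u.1 \in T then (u.1, ~~ u.2) else (val b u.1, u.2).
(** Every edge changes it: arcs of a matching change the parity within one copy, and the segments
    created by a saddle change the copy but not the point. *)
Definition side u := odd u.1 (+) u.2.
Definition arc_closed T := forall i, (val b i \in T) = (i \in T).

Lemma edgeTE T u v : edgeT a b c T u v = (v == outer u) || (v == inner T u).
Proof.
by case: u v => [i []] [j s]; rewrite /edgeT /outer /inner /=; case: (i \in T).
Qed.

Lemma outerK : involutive outer.
Proof. by case=> i []; rewrite /outer /= cmK. Qed.

Lemma side_outer u : side (outer u) = ~~ side u.
Proof. by case: u => i []; rewrite /side /outer /= cm_odd ?addNb ?addbN. Qed.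

Lemma side_inner T u : side (inner T u) = ~~ side u.
Proof.
by case: u => i s; rewrite /side /inner /=; case: ifP => _ /=; rewrite ?cm_odd ?addNb ?addbN.
Qed.

Section Closed.
Variable T : {set P}.
Hypothesis clT : arc_closed T.

Lemma innerK : involutive (inner T).
Proof.
by case=> i s; rewrite /inner /=; case iT: (i \in T) => /=; rewrite ?clT iT ?negbK ?cmK.
Qed.

Lemma edgeT_sym : symmetric (edgeT a b c T).
Proof.
by move=> u v; rewrite !edgeTE ![v == _]eq_sym (inv_eq outerK) (inv_eq innerK).
Qed.

(* Every circle alternates between the two sides, so following outer arcs from
   side 1 to side 0 and inner ones from side 0 to side 1 orients all circles. *)
Definition flow u := if side u then outer u else inner T u.

Lemma flow_inj : injective flow.
Proof.
pose g u := if side u then inner T u else outer u.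
apply: (can_inj (g := g)) => u; rewrite /flow /g; case su: (side u).
  by rewrite side_outer su outerK.
by rewrite side_inner su innerK.
Qed.

Definition flow_perm := perm flow_inj.

Lemma flow_permV u : flow_perm^-1%g u = if side u then inner T u else outer u.
Proof.
apply: (perm_inj (s := flow_perm)); rewrite permKV permE /flow.
case su: (side u).
  by rewrite side_inner su innerK.
by rewrite side_outer su outerK.
Qed.

(** The two neighbours of a point are its image and its preimage under the flow, so edges never
    leave a cycle. *)
Lemma connect_flow u v : connect (edgeT a b c T) u v = (v \in porbit flow_perm u).
Proof.
apply/idP/porbitP => [|[m ->]]; last first.
  elim: m => [|m IHm]; first by rewrite expg0 perm1 connect0.
  apply: connect_trans IHm (connect1 _).
  by rewrite expgSr permM permE edgeTE /flow; case: ifP; rewrite eqxx ?orbT.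
move=> cuv; apply/porbitP; rewrite -eq_porbit_mem; apply/eqP.
case/connectP: cuv => p; elim/last_ind: p v => [|p y IHp] v; first by move=> _ ->.
rewrite rcons_path last_rcons => /andP[pp +] ->.
rewrite -(IHp _ pp erefl); set w := last u p => ey.
have /orP[/eqP->|/eqP->] : (y == flow_perm w) || (y == flow_perm^-1%g w).
- by move: ey; rewrite edgeTE flow_permV permE /flow; case: ifP => _ //; rewrite orbC.
- exact: (porbit_perm _ 1).
by rewrite -!(porbitV flow_perm) (porbit_perm _ 1).
Qed.

Definition circle u := cclass (edgeT a b c T) u.

Lemma circle_porbit u v : (circle u == circle v) = (u \in porbit flow_perm v).
Proof. by rewrite porbit_sym -connect_flow cclass_eq //; apply: edgeT_sym. Qed.

Lemma pblock_compsT u : pblock (compsT a b c T) u = circle u.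
Proof. exact/pblock_cclass/edgeT_sym. Qed.

Lemma circle_compsT u : circle u \in compsT a b c T.
Proof. exact: imset_f. Qed.

Lemma circle_inner u : circle (inner T u) = circle u.
Proof.
by apply/eqP; rewrite eq_sym cclass_eq ?connect1 ?edgeTE ?eqxx ?orbT //; apply: edgeT_sym.
Qed.

Lemma compsT_circle C u : C \in compsT a b c T -> u \in C -> C = circle u.
Proof. by case/imsetP => v _ ->; rewrite (mem_cclass edgeT_sym) => /eqP. Qed.

End Closed.

(** * Effect of one saddle on the circles *)

Section Surgery.
Variables (T : {set P}) (i : P).
Hypotheses (clT : arc_closed T) (iT : i \notin T).
Local Notation T' := (i |: (val b i |: T)).

Lemma arc_closedU : arc_closed T'.
Proof.
move=> j; rewrite !inE clT (inv_eq (cmK b)) (inj_eq (@cm_inj _ b)).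
by rewrite orbCA.
Qed.

Lemma inner_surgery u : u.1 != i -> u.1 != val b i -> inner T' u = inner T u.
Proof. by move=> ni nbi; rewrite /inner !inE (negPf ni) (negPf nbi). Qed.

Lemma circle_before s : circle T (val b i, s) = circle T (i, s).
Proof. by rewrite -(circle_inner clT (i, s)) /inner /= (negPf iT). Qed.

Lemma circle_after j s : j \in T' -> circle T' (j, ~~ s) = circle T' (j, s).
Proof. by move=> jT; rewrite -(circle_inner arc_closedU (j, s)) /inner /= jT. Qed.

Lemma circle_disjoint u : circle T u != circle T (i, false) ->
  circle T u != circle T (i, true) -> circle T' u = circle T u.
Proof.
move=> nF nT; apply/setP => v; rewrite !inE; apply/esym.
apply: (@connect_agree _ _ _ (fun v => (v.1 == i) || (v.1 == val b i))) => [w|w].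
  by rewrite negb_or => /andP[ni nbi] z; rewrite !edgeTE inner_surgery.
rewrite -(cclass_eq (edgeT_sym clT)) -/(circle T u) -/(circle T w) => /eqP euw.
apply: contraTN isT => wi.
have : circle T w \in [set circle T (i, false); circle T (i, true)].
  case: w wi {euw} => j s /= /orP[] /eqP->; rewrite ?circle_before !inE;
  by case: s; rewrite eqxx ?orbT.
by rewrite -euw !inE (negPf nF) (negPf nT).
Qed.

Lemma circle_disjoint' u : circle T' u != circle T' (i, false) ->
  circle T' u != circle T' (val b i, false) -> circle T' u = circle T u.
Proof.
move=> nF nT; apply/setP => v; rewrite !inE.
apply: (@connect_agree _ _ _ (fun v => (v.1 == i) || (v.1 == val b i))) => [w|w].
  by rewrite negb_or => /andP[ni nbi] z; rewrite !edgeTE inner_surgery.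
rewrite -(cclass_eq (edgeT_sym arc_closedU)) -/(circle T' u) -/(circle T' w) => /eqP euw.
apply: contraTN isT => wi.
have : circle T' w \in [set circle T' (i, false); circle T' (val b i, false)].
  case: w wi {euw} => j s /= /orP[] /eqP->; rewrite !inE; case: s;
  by rewrite ?(@circle_after _ false) ?inE ?eqxx ?orbT.
by rewrite -euw !inE (negPf nF) (negPf nT).
Qed.

(** A circle missing both new strands is unchanged by the saddle; it would then contain [(i, false)]
    or [(i, true)], which lie on a new strand. *)
Lemma circle_hit u : (circle T u == circle T (i, false)) || (circle T u == circle T (i, true)) ->
  (circle T' u == circle T' (i, false)) || (circle T' u == circle T' (val b i, false)).
Proof.
move=> hit; apply/negPn/negP; rewrite negb_or => /andP[nF nT].
have eTu := circle_disjoint' nF nT.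
have hitP s : circle T u == circle T (i, s) -> circle T' (i, s) = circle T' u.
  rewrite -mem_cclass; last exact: edgeT_sym.
  rewrite -[cclass _ _]/(circle T u) -eTu mem_cclass; last exact/edgeT_sym/arc_closedU.
  by move/eqP.
case/orP: hit => /hitP e; move: nF; rewrite -e ?eqxx //.
by rewrite (@circle_after _ false) ?eqxx // !inE eqxx.
Qed.

End Surgery.

Lemma merge_or_split_even T j : arc_closed T -> j \notin T -> ~~ odd j ->
  (circle T (j, false) == circle T (j, true)) =
  (circle (j |: (val b j |: T)) (j, false) != circle (j |: (val b j |: T)) (val b j, false)).
Proof.
move=> clT jT ej; have clT' := arc_closedU j clT; set T' := j |: _ in clT' *.
(* Of the four endpoints these are the two of [side] 0, which the flow leaves along inner arcs; the
   saddle exchanges their successors. *)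
pose x : V2 := (j, false); pose y : V2 := (val b j, true).
have nxy : x != y by rewrite xpair_eqE andbF.
have jT' : j \in T' by rewrite !inE eqxx.
have bjT' : val b j \in T' by rewrite !inE eqxx orbT.
have bjT : val b j \notin T by rewrite clT.
have sx : side x = false by rewrite /side /= (negPf ej).
have sy : side y = false by rewrite /side /= cm_odd ej.
have flowE : flow_perm clT' = (tperm x y * flow_perm clT)%g.
  apply/permP => u; rewrite permM [LHS]permE [RHS]permE.
  case: tpermP => [->|->|nx ny]; rewrite /flow.
  - by rewrite sx sy /inner /= jT' (negPf bjT) cmK.
  - by rewrite sx sy /inner /= bjT' (negPf jT).
  case: ifP => // su; rewrite inner_surgery //; apply/eqP => eu.
    case: u nx su eu {ny} => k s /= nx su ek; rewrite ek in nx su.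
    by case: s nx su => // _; rewrite /side /= (negPf ej).
  case: u ny su eu {nx} => k s /= ny su ek; rewrite ek in ny su.
  by case: s ny su => // _; rewrite /side /= cm_odd ej.
rewrite -(circle_before clT jT true) (@circle_after _ _ clT (val b j) true bjT').
rewrite (circle_porbit clT) (circle_porbit clT') flowE.
by rewrite (porbit_mul_tperm _ nxy) negbK.
Qed.

(** If [i] is odd then [val b i] is even, and it names the same arc and the same saddle. *)
Lemma merge_or_split T i : arc_closed T -> i \notin T ->
  (circle T (i, false) == circle T (i, true)) =
  (circle (i |: (val b i |: T)) (i, false) != circle (i |: (val b i |: T)) (val b i, false)).
Proof.
move=> clT iT; have [oi|/(merge_or_split_even clT iT)//] := boolP (odd i).
rewrite -!(circle_before clT iT) merge_or_split_even ?clT ?cm_odd ?oi //.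
by rewrite cmK setUCA eq_sym.
Qed.

End Cobordism.

(** * Saddles as operators on states *)

Section Saddle.
Variables (R : comNzRingType) (n : nat) (a b c : cm n).
Local Notation P := (pt n).
Local Notation V2 := (P * bool)%type.
Local Notation state := {ffun {set {set V2}} -> R^o}.
Local Notation circle := (circle a b c).
Local Notation compsT := (compsT a b c).
Local Notation arc_closed := (arc_closed b).
Implicit Types (T : {set P}) (S : {set {set V2}}).

Section Step.
Variables (T : {set P}) (i : P).
Hypotheses (clT : arc_closed T) (iT : i \notin T).
Local Notation T' := (i |: (val b i |: T)).

Let clT' : arc_closed T' := arc_closedU i clT.

Lemma saddleE S : saddle R a b c T i S =
  if circle T (i, false) != circle T (i, true)
  then merge_b R (circle T (i, false)) (circle T (i, true)) (circle T' (i, false)) S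
  else split_b R (circle T (i, false)) (circle T' (i, false)) (circle T' (val b i, false)) S.
Proof. by rewrite /saddle !(pblock_compsT a c clT) !(pblock_compsT a c clT'). Qed.

(** An old circle through [(j, false)] must be [circle T (j, false)], which is taken out of [S];
    thus a new circle has no label before it is created. *)
Lemma new_circle_notin (j : P) S : j \in T' -> S \subset compsT T ->
  circle T' (j, false) \notin S :\ circle T (j, false).
Proof.
move=> jT' /subsetP sS; rewrite inE andbC; apply/negP=> /andP[/sS D_old /negP[]]; rewrite inE.
by apply/eqP/(compsT_circle clT D_old)/cclass_id.
Qed.

Let iT' : i \in T'. Proof. by rewrite !inE eqxx. Qed.
Let biT' : val b i \in T'. Proof. by rewrite !inE eqxx orbT. Qed.

Lemma circle_old v : circle T v != circle T (i, false) -> circle T v != circle T (i, true) ->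
  forall j : P, j \in [set i; val b i] -> circle T v != circle T' (j, false).
Proof.
move=> nF _ j jP; apply: contraNneq nF => e.
have : (j, false) \in circle T v by rewrite e cclass_id.
rewrite (mem_cclass (edgeT_sym _ _ clT)) -/(circle T v) => /eqP->.
by move: jP; rewrite !inE => /orP[]/eqP-> //; rewrite -/(circle T _) circle_before.
Qed.

Lemma supported_saddle S : S \subset compsT T -> supported (compsT T') (saddle R a b c T i S).
Proof.
move=> /subsetP sS; rewrite saddleE.
have sub C : C \in S -> C != circle T (i, false) -> C != circle T (i, true) -> C \in compsT T'.
  move=> /sS /imsetP[u _ ->] nF nT.
  by rewrite -[[set _ | _]]/(circle T u) -(circle_disjoint clT iT nF nT) circle_compsT.
case: ifP => [_|/negbFE/eqP e].
  apply: supported_merge; last exact: circle_compsT.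
  by apply/subsetP => C; rewrite !inE => /and3P[nT nF CS]; apply: sub.
apply: supported_split; [|exact: circle_compsT|exact: circle_compsT].
by apply/subsetP => C; rewrite !inE => /andP[nF CS]; apply: sub; rewrite // -e.
Qed.

(** Following the point [v] determines which circle receives the factor x. When the circle of [v]
    splits, [v] lies on one of the two parts, and [split_mulx] allows both. *)
Lemma saddle_mulx v S : S \subset compsT T ->
  mulx (circle T' v) (saddle R a b c T i S) =
  lin_ext (saddle R a b c T i) (mulx_b R (circle T v) S).
Proof.
move=> sS; have ms := merge_or_split a c clT iT.
have DS := new_circle_notin iT' sS; have D'S := new_circle_notin biT' sS.
rewrite (circle_before a c clT iT) in D'S.
have hit := @circle_hit _ a b c T i clT v.
rewrite (eq_lin_ext saddleE) saddleE.
case: ifP => [neC|/negbFE/eqP eC]; last move/eqP: (eC).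
  move: (neC); rewrite ms negbK => /eqP eD; rewrite -eD orbb in hit.
  apply: merge_mulx => //; first by apply: contra DS => /setD1P[].
  case: ifP => [/hit/eqP//|/negbT]; rewrite negb_or => /andP[nF nT].
  by rewrite circle_disjoint // circle_old // set21.
rewrite ms => neD; apply: split_mulx => //.
case: ifP => [eF|/negbT nF].
  by move: hit; rewrite eF => /(_ isT)/orP[]/eqP; [left|right].
have nT := nF; rewrite eC in nT.
by rewrite circle_disjoint // !circle_old ?set21 ?set22.
Qed.

Lemma saddle_nu S : 2%N \in [pchar R] -> S \subset compsT T ->
  nu (saddle R a b c T i S) = lin_ext (saddle R a b c T i) (nu_b R S).
Proof.
move=> char2 sS; have ms := merge_or_split a c clT iT.
have DS := new_circle_notin iT' sS; have D'S := new_circle_notin biT' sS.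
rewrite (circle_before a c clT iT) in D'S.
rewrite (eq_lin_ext saddleE) saddleE.
case: ifP => [neC|/negbFE]; last by rewrite ms => neD; apply: split_nu.
by apply: merge_nu => //; apply: contra DS => /setD1P[].
Qed.

End Step.

Definition saddles T (s : seq P) (st : state) : state :=
  (foldl (saddle_step a b c) (T, st) s).2.

Definition saddled T (s : seq P) := foldl (fun T i => i |: (val b i |: T)) T s.

Lemma saddles_is_linear T s : linear (saddles T s).
Proof.
elim: s T => [|i s IHs] T k u v //; rewrite /saddles /= /saddle_step /= linearP.
exact: IHs.
Qed.

HB.instance Definition _ T s :=
  GRing.isLinear.Build R state state *:%R (saddles T s) (saddles_is_linear T s).

(** Naming each arc once, by its lower endpoint, ensures that no later saddle sits at a point
    already operated on. *)
Definition arc_seq T s :=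
  [&& all (fun i => (i \notin T) && (i < val b i)%N) s & uniq s].

Lemma arc_seq_cons T i s : arc_closed T -> arc_seq T (i :: s) ->
  i \notin T /\ arc_seq (i |: (val b i |: T)) s.
Proof.
move=> clT /and3P[/= /andP[/andP[iT ltib] /allP alls] is_ us]; split=> //.
apply/andP; split=> //; apply/allP => j js; have /andP[jT ltj] := alls j js.
rewrite ltj andbT !inE !negb_or jT andbT; apply/andP; split.
  by apply: contraNneq is_ => <-.
by apply: contraTneq ltj => ->; rewrite cmK -leqNgt ltnW.
Qed.

Lemma supported_saddles T s st : arc_closed T -> arc_seq T s ->
  supported (compsT T) st -> supported (compsT (saddled T s)) (saddles T s st).
Proof.
elim: s T st => [//|i s IHs] T st clT ats sst; have [iT at'] := arc_seq_cons clT ats.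
rewrite /saddles /= /saddle_step /=; apply: IHs => //; first exact: arc_closedU.
by apply: supported_lin_ext sst => S sS; apply: supported_saddle.
Qed.

Lemma saddles_nu T s st : 2%N \in [pchar R] -> arc_closed T -> arc_seq T s ->
  supported (compsT T) st -> saddles T s (nu st) = nu (saddles T s st).
Proof.
move=> char2; elim: s T st => [//|i s IHs] T st clT ats sst.
have [iT at'] := arc_seq_cons clT ats; rewrite /saddles /= /saddle_step /=.
rewrite -[RHS]IHs //; last 2 first.
- exact: arc_closedU.
- by apply: supported_lin_ext sst => S sS; apply: supported_saddle.
congr (_ (foldl _ (_, _) _)).
pose F := lin_ext (saddle R a b c T i) \o nu (R:=R) (Z:=_).
pose G := nu (R:=R) (Z:=_) \o lin_ext (saddle R a b c T i).
apply: (@supported_eq _ _ _ (compsT T) st F G) sst => S sS.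
by rewrite /= nu_delta lin_ext_delta saddle_nu.
Qed.

Lemma saddles_mulx T s st v : arc_closed T -> arc_seq T s ->
  supported (compsT T) st ->
  saddles T s (mulx (circle T v) st) = mulx (circle (saddled T s) v) (saddles T s st).
Proof.
elim: s T st => [//|i s IHs] T st clT ats sst.
have [iT at'] := arc_seq_cons clT ats; rewrite /saddles /= /saddle_step /=.
rewrite -[RHS]IHs //; last 2 first.
- exact: arc_closedU.
- by apply: supported_lin_ext sst => S sS; apply: supported_saddle.
congr (_ (foldl _ (_, _) _)).
pose F := lin_ext (saddle R a b c T i) \o mulx (circle T v).
pose G := mulx (circle (i |: (val b i |: T)) v) \o lin_ext (saddle R a b c T i).
apply: (@supported_eq _ _ _ (compsT T) st F G) sst => S sS.
by rewrite /= mulx_delta lin_ext_delta saddle_mulx.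
Qed.

Lemma mem_saddled T s j : arc_closed T ->
  (j \in saddled T s) = [|| j \in T, j \in s | val b j \in s].
Proof.
elim: s T => [|i s IHs] T clT /=; first by rewrite orbF.
rewrite IHs; last exact: arc_closedU.
by rewrite !inE (inv_eq (cmK b)) -!orbA; do !bool_congr.
Qed.

Lemma arc_closed0 : arc_closed set0. Proof. by move=> j; rewrite !inE. Qed.

Lemma arc_seq_arcs : arc_seq set0 (arcs b).
Proof.
rewrite /arc_seq filter_uniq ?enum_uniq // andbT; apply/allP => i.
by rewrite mem_filter inE => /andP[].
Qed.

Lemma saddled_arcs : saddled set0 (arcs b) = setT.
Proof.
apply/setP => j; rewrite mem_saddled; last exact: arc_closed0.
rewrite /arcs !mem_filter cmK -enumT !mem_enum !inE !andbT -neq_ltn.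
by have := cm_neq b j; rewrite eq_sym.
Qed.

End Saddle.

(** * Bilinear extension from finite bases *)

Section Bilinear.
Variables (R : comNzRingType) (T T' U : finType) (f : T -> T' -> {ffun U -> R^o}).

Definition bilin_ext (u : {ffun T -> R^o}) (v : {ffun T' -> R^o}) : {ffun U -> R^o} :=
  \sum_(s : T) \sum_(t : T') (u s * v t) *: f s t.

Lemma bilin_extl u v : bilin_ext u v = lin_ext (fun s => lin_ext (f s) v) u.
Proof.
apply: eq_bigr => s _; rewrite /lin_ext scaler_sumr; apply: eq_bigr => t _.
by rewrite scalerA.
Qed.

Lemma bilin_extr u v : bilin_ext u v = lin_ext (fun t => lin_ext (f^~ t) u) v.
Proof.
rewrite /bilin_ext exchange_big; apply: eq_bigr => t _; rewrite /lin_ext scaler_sumr.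
by apply: eq_bigr => s _; rewrite scalerA mulrC.
Qed.

Lemma bilin_linear_l v : linear (bilin_ext^~ v).
Proof. by move=> k x y; rewrite !bilin_extl linearP. Qed.

Lemma bilin_linear_r u : linear (bilin_ext u).
Proof. by move=> k x y; rewrite !bilin_extr linearP. Qed.

Lemma bilin_delta s t : bilin_ext (delta R s) (delta R t) = f s t.
Proof. by rewrite bilin_extl !lin_ext_delta. Qed.

Lemma bilinear_eq (L M : {ffun T -> R^o} -> {ffun T' -> R^o} -> {ffun U -> R^o}) :
  (forall v, linear (L^~ v)) -> (forall u, linear (L u)) ->
  (forall v, linear (M^~ v)) -> (forall u, linear (M u)) ->
  (forall s t, L (delta R s) (delta R t) = M (delta R s) (delta R t)) ->
  forall u v, L u v = M u v.
Proof.
move=> Ll Lr Ml Mr eqLM u v.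
pose mk (V W : lmodType R) (g : V -> W) (lg : linear g) : {linear V -> W} :=
  HB.pack g (GRing.isLinear.Build _ _ _ _ g lg).
apply: (lin_ext_eq (F := mk _ _ _ (Ll v)) (G := mk _ _ _ (Ml v))) => s /=.
by apply: (lin_ext_eq (F := mk _ _ _ (Lr _)) (G := mk _ _ _ (Mr _))) => t /=.
Qed.

End Bilinear.

(** * Renaming circles *)

Section Push.
Variables (R : comNzRingType) (Z Z' : finType) (g : Z -> Z') (A : {set Z}).
Hypothesis injg : {in A &, injective g}.
Implicit Types (S : {set Z}).

(** Serves to pass from the circles after the last saddle, which are sets of points of two copies,
    to the circles of a^!c; that renaming is injective on genuine circles only, hence the set
    [A]. *)
Definition push : {ffun {set Z} -> R^o} -> {ffun {set Z'} -> R^o} :=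
  lin_ext (fun S => delta R (g @: S)).
HB.instance Definition _ := GRing.Linear.on push.

Lemma push_delta S : push (delta R S) = delta R (g @: S).
Proof. exact: lin_ext_delta. Qed.

Lemma mem_imset_in k S : k \in A -> S \subset A -> (g k \in g @: S) = (k \in S).
Proof.
move=> kA /subsetP sS; apply/imsetP/idP => [[j jS /injg ->//]|kS]; last by exists k.
exact: sS.
Qed.

Lemma imset_setD1 k S : k \in S -> S \subset A -> g @: (S :\ k) = (g @: S) :\ g k.
Proof.
move=> kS sS; have kA := subsetP sS _ kS.
by rewrite -{2}(setD1K kS) imsetU1 setU1K // mem_imset_in ?setD11 //
  (subset_trans (subsetDl _ _)).
Qed.

Lemma nu_b_imset S : S \subset A ->
  nu_b R (g @: S) = \sum_(k in S) delta R (g @: (S :\ k)).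
Proof.
move=> sS; rewrite /nu_b big_imset /=; last first.
  by move=> j k /(subsetP sS) jA /(subsetP sS) kA; apply: injg.
by apply: eq_bigr => k kS; rewrite imset_setD1.
Qed.

Lemma mulx_b_imset k S : k \in A -> S \subset A ->
  mulx_b R (g k) (g @: S) = if k \in S then 0 else delta R (g @: (k |: S)).
Proof. by move=> kA sS; rewrite /mulx_b mem_imset_in // imsetU1. Qed.

Lemma push_nu u : supported A u -> nu (push u) = push (nu u).
Proof.
pose F := nu (R:=R) (Z:=_) \o push; pose G := push \o nu (R:=R) (Z:=_).
move=> su; apply: (@supported_eq _ _ _ A u F G) su => S sS.
rewrite /= push_delta !nu_delta nu_b_imset // linear_sum /=.
by apply: eq_bigr => k _; rewrite push_delta.
Qed.

Lemma push_mulx k u : k \in A -> supported A u -> mulx (g k) (push u) = push (mulx k u).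
Proof.
pose F := mulx (R:=R) (Z:=_) (g k) \o push; pose G := push \o mulx (R:=R) (Z:=_) k.
move=> kA su; apply: (@supported_eq _ _ _ A u F G) su => S sS.
rewrite /= push_delta !mulx_delta mulx_b_imset // /mulx_b.
by case: ifP => _; rewrite ?linear0 ?push_delta.
Qed.

End Push.

Lemma nu_b_setU (R : comNzRingType) (Z : finType) (S S' : {set Z}) : [disjoint S & S'] ->
  nu_b R (S :|: S') = \sum_(k in S) delta R ((S :\ k) :|: S')
                    + \sum_(k in S') delta R (S :|: (S' :\ k)).
Proof.
move=> dSS; rewrite /nu_b (big_setID S) /= setUK setDUl setDv set0U.
rewrite (setDidPl _); last by rewrite disjoint_sym.
congr (_ + _); apply: eq_bigr => k kS; rewrite setDUl; congr (delta _ (_ :|: _)).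
  by rewrite setD1_notin // (disjointFr dSS).
by rewrite setD1_notin // (disjointFl dSS).
Qed.

Lemma connect_invariant (V : finType) (e : rel V) (Q : V -> Prop) v w :
  Q v -> (forall x y, Q x -> e x y -> Q y) -> connect e v w -> Q w.
Proof.
move=> Qv step /connectP[p]; elim/last_ind: p w => [|p y IHp] w; first by move=> _ ->.
by rewrite rcons_path last_rcons => /andP[pp ey] ->; apply: step (IHp _ pp erefl) ey.
Qed.

(** * Circles before the first and after the last saddle *)

Section EndCircles.
Variables (n : nat) (a b c : cm n).
Local Notation P := (pt n).
Local Notation circle := (circle a b c).

Definition copy (s : bool) (C : {set P}) : {set P * bool} := [set ((v : P), s) | v in C].

Lemma copy_inj s : injective (copy s).
Proof. by apply: imset_inj => x y []. Qed.

Lemma arel_sym (a' b' : cm n) : symmetric (arel a' b').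
Proof. by move=> x y; rewrite /arel ![y == _]eq_sym !(inv_eq (cmK _)). Qed.

Lemma circle_start (x : P) s :
  circle set0 (x, s) = copy s (cclass (if s then arel b c else arel a b) x).
Proof.
set e := if s then _ else _; apply/setP => -[y t]; rewrite !inE.
apply/idP/imsetP => [|[z + [-> ->]]].
  move=> cxy; have [] : connect e x (y, t).1 /\ (y, t).2 = s.
    apply: (connect_invariant (Q := fun w => connect e x w.1 /\ w.2 = s) _ _ cxy) => //.
    move=> [j u] [k v] /= [cj ->]; rewrite edgeTE /outer /inner /= inE => /orP[]/eqP[-> ->];
    by split=> //; apply: connect_trans cj (connect1 _); rewrite /e /arel; case: (s);
      rewrite eqxx ?orbT.
  by move=> /= cy ->; exists y; rewrite ?inE.
rewrite inE; apply: (connect_invariant (Q := fun z => connect _ (x, s) (z, s))) => //.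
move=> j k cj ejk; apply: connect_trans cj (connect1 _).
rewrite edgeTE /outer /inner /= inE; move: ejk; rewrite /e /arel.
by case: (s) => /orP[]/eqP->; rewrite eqxx ?orbT.
Qed.

(** Once all arcs of [b] are replaced by segments between the copies, contracting these segments
    leaves the arcs of [a] and [c]. *)
Lemma connect_final (x y : P) s t :
  connect (edgeT a b c setT) (x, s) (y, t) = connect (arel a c) x y.
Proof.
have vert i u : connect (edgeT a b c setT) (i, u) (i, ~~ u).
  by rewrite connect1 // edgeTE /inner inE eqxx orbT.
apply/idP/idP.
  apply: (connect_invariant (Q := fun w => connect _ x w.1)) => // -[j u] [k v] /= cj.
  rewrite edgeTE /outer /inner /= inE => /orP[]/eqP[-> _] //.
  by apply: connect_trans cj (connect1 _); rewrite /arel; case: u; rewrite eqxx ?orbT.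
(* The invariant asks for both copies of [z]: arcs of [a] are available only in the first copy and
   arcs of [c] only in the second. *)
move=> cxy; move: t; pose Q z := forall t, connect (edgeT a b c setT) (x, s) (z, t).
apply: (connect_invariant (Q := Q) _ _ cxy) => [t|j k cj ejk t].
  have [->|ts] := eqVneq t s; first exact: connect0.
  by have -> : t = ~~ s by case: (s) (t) ts => [] [].
have [u ->] : exists u, k = if u then val c j else val a j.
  by case/orP: ejk => /eqP->; [exists false|exists true].
apply: connect_trans (cj u) _.
have cu : connect (edgeT a b c setT) (j, u) (outer a c (j, u)).
  by rewrite connect1 // edgeTE eqxx.
apply: connect_trans cu _; rewrite /outer /=.
by case: u t => [] []; rewrite ?connect0 //; apply: vert.
Qed.

Lemma circle_final (x : P) s : [set v.1 | v in circle setT (x, s)] = cclass (arel a c) x.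
Proof.
apply/setP => y; rewrite inE; apply/imsetP/idP => [[[z t] + ->]|cxy].
  by rewrite inE connect_final.
by exists (y, s) => //; rewrite inE connect_final.
Qed.

Lemma fst_circle_inj :
  {in compsT a b c setT &, injective (fun D : {set P * bool} => [set v.1 | v in D])}.
Proof.
move=> _ _ /imsetP[[x s] _ ->] /imsetP[[y t] _ ->].
rewrite -!/(circle _ _) !circle_final => /eqP; rewrite (cclass_eq (@arel_sym _ _)) => cxy.
by apply/eqP; rewrite cclass_eq ?connect_final //; apply: edgeT_sym => i; rewrite !inE.
Qed.

End EndCircles.

(** * The formal splitting given by [d X + X d = 1] *)

Section Splitting.
Variables (R : comNzRingType) (H Ht : lmodType R) (d X : {linear H -> H}).
Variables (lift : {linear Ht -> H}) (pr : {linear H -> Ht}) (mul : H -> H -> H).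
Hypotheses (XX : forall u, X (X u) = 0) (dd : forall u, d (d u) = 0)
  (dX : forall u, d (X u) + X (d u) = u)
  (pr_lift : forall s, pr (lift s) = s) (X_lift_pr : forall u, X (lift (pr u)) = X u)
  (pr_X : forall u, pr (X u) = 0)
  (mul0 : forall u, mul u 0 = 0)
  (d_mul : forall u v, d (mul u v) = mul (d u) v + mul u (d v))
  (X_mul_l : forall u v, X (mul u v) = mul (X u) v)
  (X_mul_r : forall u v, X (mul u v) = mul u (X v)).
Implicit Types (u v : H) (s t : Ht).

Local Notation rmul s t := (pr (mul (lift s) (lift t))).

Lemma XdX u : X (d (X u)) = X u.
Proof. by rewrite -[RHS](dX (X u)) XX linear0 add0r. Qed.

Definition lift1 s := d (X (lift s)).
Definition liftx s := X (lift s).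

(** Write [s], [t] for the lifts. As [d] is a derivation killing [d (X t)], the product of [d (X s)]
    and [d (X t)] is [d] of the product of [X s] and [d (X t)]. Moving X across, the latter is the
    product of [s] and [X (d (X t)) = X t], that is, X of the product of [s] and [t]. *)
Lemma lift1_mul s t : lift1 (rmul s t) = mul (lift1 s) (lift1 t).
Proof.
rewrite /lift1 X_lift_pr -[RHS]addr0 -(mul0 (X (lift s))) -(dd (X (lift t))) -d_mul.
by rewrite -[in RHS]X_mul_l [in RHS]X_mul_r XdX -X_mul_r.
Qed.

Lemma lift1_mulx s t : liftx (rmul s t) = mul (lift1 s) (liftx t).
Proof. by rewrite /liftx X_lift_pr -X_mul_r !X_mul_l XdX. Qed.

Lemma liftx_mul s t : liftx (rmul s t) = mul (liftx s) (lift1 t).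
Proof. by rewrite /liftx X_lift_pr -X_mul_l !X_mul_r XdX. Qed.

Lemma liftx_mulx s t : mul (liftx s) (liftx t) = 0.
Proof. by rewrite -X_mul_l -X_mul_r XX. Qed.

Lemma lift1_pr_add u : lift1 (pr u) + liftx (pr (d u)) = u.
Proof. by rewrite /lift1 /liftx !X_lift_pr dX. Qed.

Lemma pr_lift1 s t : pr (lift1 s + liftx t) = s.
Proof.
rewrite linearD /= /lift1 /liftx pr_X addr0 -[RHS]pr_lift -[in RHS](dX (lift s)).
by rewrite linearD /= pr_X addr0.
Qed.

Lemma pr_d_lift1 s t : pr (d (lift1 s + liftx t)) = t.
Proof.
by rewrite linearD /= dd add0r -{2}(pr_lift1 t 0) /liftx !linear0 addr0.
Qed.

(** Serves for the unit, which carries no label x and so is killed by nu. *)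
Lemma lift1_pr u : d u = 0 -> lift1 (pr u) = u.
Proof. by move=> du; rewrite -[RHS]lift1_pr_add du linear0 /liftx !linear0 addr0. Qed.

End Splitting.

(** * The tensor product with A as pairs of components along 1 and x *)

Section Tensor.
Variables (R : comNzRingType) (B' : finType).
Local Notation Ht := {ffun B' -> R^o}.
Local Notation Tt := {ffun B' * bool -> R^o}.

Definition slice (s : bool) (u : Tt) : Ht := [ffun r => u (r, s)].
Lemma slice_is_linear s : linear (slice s).
Proof. by move=> k u v; apply/ffunP => r; rewrite !ffunE. Qed.
HB.instance Definition _ s := GRing.isLinear.Build R Tt Ht *:%R (slice s) (slice_is_linear s).

Lemma slice_delta s r s' : slice s (delta R (r, s')) = if s == s' then delta R r else 0.
Proof.
by apply/ffunP => r'; case: eqP => [->|/eqP/negPf ns]; rewrite !ffunE xpair_eqE ?eqxx ?ns ?andbT ?andbF.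
Qed.

Definition unslice (w0 w1 : Ht) : Tt := [ffun p => if p.2 then w1 p.1 else w0 p.1].

Lemma slice_unslice s w0 w1 : slice s (unslice w0 w1) = if s then w1 else w0.
Proof. by apply/ffunP => r; rewrite !ffunE /=; case: s. Qed.

Lemma unslice_slice u : unslice (slice false u) (slice true u) = u.
Proof. by apply/ffunP => -[r []]; rewrite !ffunE. Qed.

End Tensor.

(** * The arc algebra over an abstract labelled basis *)

(* The standard basis of H_n is an abstract finite type [B] labelled by triples;
   unification is intractable on the nested subtypes making up [hb n]. *)
Section ArcAlgebra.
Variables (R : comNzRingType) (n : nat).
Local Notation P := (pt n).
Variables (B : finType) (lab : B -> trip n).
Hypotheses (lab_inj : injective lab)
  (lab_valid : forall h, (lab h).2 \subset comps (lab h).1.1 (lab h).1.2)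
  (lab_onto : forall a b (S : {set {set P}}), S \subset comps a b -> exists h, lab h = (a, b, S)).
Local Notation H := {ffun B -> R^o}.

Variable mulb : B -> B -> H.
Hypotheses (mulb_neq : forall h1 h2, (lab h1).1.2 != (lab h2).1.1 -> mulb h1 h2 = 0)
  (mulbE : forall h1 h2 a b c S1 S2, lab h1 = (a, b, S1) -> lab h2 = (b, c, S2) ->
    let S12 := [set [set ((v : P), false) | v in C] | C : {set P} in S1] :|:
               [set [set ((v : P), true) | v in C] | C : {set P} in S2] in
    mulb h1 h2 = [ffun h => if (lab h).1 == (a, c) then
      \sum_(Sf : {set {set P * bool}} |
          [set [set v.1 | v in D] | D : {set P * bool} in Sf] == (lab h).2)
        saddles a b c set0 (arcs b) (delta R S12) Sf
      else 0]).
Implicit Types (a b c : cm n) (S : {set {set P}}) (u v : H).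

Local Notation hmul := (bilin_ext mulb).

HB.instance Definition _ u :=
  GRing.isLinear.Build R H H *:%R (hmul u) (bilin_linear_r mulb u).

Definition hmulr v u := hmul u v.
HB.instance Definition _ v :=
  GRing.isLinear.Build R H H *:%R (hmulr v) (bilin_linear_l mulb v).

Definition bdelta (t : trip n) : H := [ffun h => (lab h == t)%:R].

(** A label set containing something other than a circle of a^!b is sent to 0, since no basis
    element has that label. *)
Definition hemb a b : {ffun {set {set P}} -> R^o} -> H :=
  lin_ext (fun S => bdelta (a, b, S)).
HB.instance Definition _ a b := GRing.Linear.on (hemb a b).

Lemma hemb_delta a b S : hemb a b (delta R S) = bdelta (a, b, S).
Proof. exact: lin_ext_delta. Qed.

Lemma hemb_nu_b a b S : hemb a b (nu_b R S) = \sum_(k in S) bdelta (a, b, S :\ k).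
Proof. by rewrite linear_sum; apply: eq_bigr => k _; rewrite /= hemb_delta. Qed.

Lemma bdelta_lab (h : B) : bdelta (lab h) = delta R h.
Proof. by apply/ffunP => h'; rewrite !ffunE (inj_eq lab_inj). Qed.

Lemma bdelta_valid a b S : S \subset comps a b ->
  exists2 h, lab h = (a, b, S) & bdelta (a, b, S) = delta R h.
Proof. by move=> /lab_onto[h eh]; exists h; rewrite // -eh bdelta_lab. Qed.

Lemma bdelta_invalid a b S : ~~ (S \subset comps a b) -> bdelta (a, b, S) = 0.
Proof.
move=> sS; apply/ffunP => h; rewrite !ffunE; case: eqP => // eh.
by have := lab_valid h; rewrite /= eh (negPf sS).
Qed.

Definition hnu : H -> H :=
  lin_ext (fun h => hemb (lab h).1.1 (lab h).1.2 (nu_b R (lab h).2)).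
Definition hX : H -> H :=
  lin_ext (fun h => hemb (lab h).1.1 (lab h).1.2
                      (mulx_b R (kappa0 (lab h).1.1 (lab h).1.2) (lab h).2)).
HB.instance Definition _ := GRing.Linear.on hnu.
HB.instance Definition _ := GRing.Linear.on hX.

Lemma hnu_hemb a b st : supported (comps a b) st -> hnu (hemb a b st) = hemb a b (nu st).
Proof.
pose L := hnu \o hemb a b; pose M := hemb a b \o nu (R:=R) (Z:=_).
move=> su; apply: (@supported_eq _ _ _ _ st L M) su => S sS /=.
have [h eh eS] := bdelta_valid sS.
by rewrite hemb_delta eS /hnu lin_ext_delta eh nu_delta.
Qed.

Lemma hX_hemb a b st : supported (comps a b) st ->
  hX (hemb a b st) = hemb a b (mulx (kappa0 a b) st).
Proof.
pose L := hX \o hemb a b; pose M := hemb a b \o mulx (R:=R) (Z:=_) (kappa0 a b).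
move=> su; apply: (@supported_eq _ _ _ _ st L M) su => S sS /=.
have [h eh eS] := bdelta_valid sS.
by rewrite hemb_delta eS /hX lin_ext_delta eh mulx_delta.
Qed.

Lemma hb_eq (U : finType) (L M : {linear H -> {ffun U -> R^o}}) :
  (forall a b S, S \subset comps a b ->
     L (hemb a b (delta R S)) = M (hemb a b (delta R S))) -> L =1 M.
Proof.
move=> eqLM; apply: lin_ext_eq => h; rewrite -bdelta_lab.
have := lab_valid h; case: (lab h) => [[a b] S] /= sS.
by rewrite -hemb_delta eqLM.
Qed.

Hypothesis n_gt0 : (0 < n)%N.

Lemma marked_proof : (0 < n.*2)%N. Proof. by rewrite double_gt0. Qed.
Definition marked : P := Ordinal marked_proof.

Lemma kappa0E a b : kappa0 a b = cclass (arel a b) marked.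
Proof.
by rewrite /kappa0 (big_pred1 marked) // => i; rewrite -[RHS]val_eqE.
Qed.

Lemma kappa0_comps a b : kappa0 a b \in comps a b.
Proof. by rewrite kappa0E imset_f. Qed.

Hypothesis char2 : 2%N \in [pchar R].

Lemma hX_hX u : hX (hX u) = 0.
Proof.
apply: (hb_eq (L := hX \o hX) (M := \0)) => a b S sS /=.
have s1 : supported (comps a b) (delta R S) by apply: supported_delta.
by rewrite !hX_hemb ?mulx_mulx ?linear0 //; apply: supported_mulx; rewrite ?kappa0_comps.
Qed.

Lemma hnu_hnu u : hnu (hnu u) = 0.
Proof.
apply: (hb_eq (L := hnu \o hnu) (M := \0)) => a b S sS /=.
have s1 : supported (comps a b) (delta R S) by apply: supported_delta.
by rewrite !hnu_hemb ?nu_nu ?linear0 //; apply: supported_nu.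
Qed.

Lemma hnu_hX u : hnu (hX u) + hX (hnu u) = u.
Proof.
apply: (hb_eq (L := (hnu \o hX) \+ (hX \o hnu)) (M := idfun)) => a b S sS /=.
have s1 : supported (comps a b) (delta R S) by apply: supported_delta.
rewrite hX_hemb // hnu_hemb; last by apply: supported_mulx; rewrite ?kappa0_comps.
rewrite hnu_hemb // hX_hemb; last exact: supported_nu.
by rewrite -linearD /= nu_mulx.
Qed.

(** * Products of basis elements *)

Section Product.
Variables a b c : cm n.
Implicit Types st : {ffun {set {set P * bool}} -> R^o}.

Definition start_labels S1 S2 : {set {set P * bool}} := copy false @: S1 :|: copy true @: S2.

Definition readout : {ffun {set {set P * bool}} -> R^o} -> H :=
  hemb a c \o push (R:=R) (fun D : {set P * bool} => [set v.1 | v in D]).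
HB.instance Definition _ := GRing.Linear.on readout.

Lemma readoutE st : readout st =
  [ffun h => if (lab h).1 == (a, c) then
     \sum_(Sf : {set {set P * bool}} |
        [set [set v.1 | v in D] | D : {set P * bool} in Sf] == (lab h).2) st Sf
   else 0].
Proof.
pose f (Sf : {set {set P * bool}}) :=
  bdelta (a, c, [set [set v.1 | v in D] | D : {set P * bool} in Sf]).
have -> : readout st = lin_ext f st.
  by apply: lin_ext_eq => Sf; rewrite /= /readout /= push_delta hemb_delta lin_ext_delta.
apply/ffunP => h; rewrite sum_ffunE ffunE; under eq_bigr => Sf _ do rewrite !ffunE.
case: eqP => [eh|nh].
  rewrite [RHS]big_mkcond; apply: eq_bigr => Sf _.
  rewrite [lab h]surjective_pairing eh xpair_eqE eqxx eq_sym /=.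
  by case: eqP; rewrite /GRing.scale /= ?mulr1 ?mulr0.
rewrite big1 // => Sf _; case: eqP => [eh|]; last by rewrite scaler0.
by case: nh; rewrite eh.
Qed.

Lemma hmul_bdelta S1 S2 : S1 \subset comps a b -> S2 \subset comps b c ->
  hmul (bdelta (a, b, S1)) (bdelta (b, c, S2)) =
  readout (saddles a b c set0 (arcs b) (delta R (start_labels S1 S2))).
Proof.
move=> /bdelta_valid[h1 e1 ->] /bdelta_valid[h2 e2 ->].
by rewrite bilin_delta (mulbE e1 e2) readoutE.
Qed.

Lemma comps_start_l C : C \in comps a b -> copy false C \in compsT a b c set0.
Proof.
case/imsetP => x _ ->; rewrite -[[set _ | _]]/(cclass _ _).
by rewrite -[cclass _ _](erefl : (if false then cclass (arel b c) x else cclass (arel a b) x) = _)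
  -(circle_start a b c x false) circle_compsT.
Qed.

Lemma comps_start_r C : C \in comps b c -> copy true C \in compsT a b c set0.
Proof.
case/imsetP => x _ ->; rewrite -[[set _ | _]]/(cclass _ _).
by rewrite -(circle_start a b c x true) circle_compsT.
Qed.

Lemma start_labels_sub S1 S2 : S1 \subset comps a b -> S2 \subset comps b c ->
  start_labels S1 S2 \subset compsT a b c set0.
Proof.
move=> /subsetP s1 /subsetP s2; rewrite subUset; apply/andP; split; apply/subsetP => D;
  case/imsetP => C CS ->; [exact/comps_start_l/s1 | exact/comps_start_r/s2].
Qed.

(** Circles are nonempty; the two copies of the empty set would coincide. *)
Lemma copy_disjoint C C' : C \in comps a b -> copy false C != copy true C'.
Proof.
case/imsetP => x _ ->; apply/eqP => /setP/(_ (x, false)).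
rewrite imset_f ?inE ?connect0 // => /esym/imsetP[y _] //.
Qed.

Lemma supported_final st : supported (compsT a b c set0) st ->
  supported (compsT a b c setT) (saddles a b c set0 (arcs b) st).
Proof.
by rewrite -[in setT](saddled_arcs b); apply: supported_saddles;
  [apply: arc_closed0|apply: arc_seq_arcs].
Qed.

Lemma supported_push st : supported (compsT a b c setT) st ->
  supported (comps a c) (push (fun D : {set P * bool} => [set v.1 | v in D]) st).
Proof.
move=> sst; apply: (supported_lin_ext _ sst) => Sf /subsetP sSf.
apply/supported_delta/subsetP => C /imsetP[D DS ->].
have /imsetP[[x s] _ ->] := sSf _ DS.
by rewrite -/(circle a b c setT (x, s)) circle_final imset_f.
Qed.

Lemma hnu_readout st : supported (compsT a b c setT) st ->
  hnu (readout st) = readout (nu st).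
Proof.
move=> sst; rewrite /readout /= hnu_hemb; last exact: supported_push.
by rewrite (push_nu (@fst_circle_inj _ a b c)).
Qed.

(** The copy [s] is free, as both copies of the marked point end on the same circle. Tracing X back
    through the saddles, [s = false] lands in the left factor and [s = true] in the right one. *)
Lemma hX_readout s st : supported (compsT a b c setT) st ->
  hX (readout st) = readout (mulx (circle a b c setT (marked, s)) st).
Proof.
move=> sst; rewrite /readout /= hX_hemb; last exact: supported_push.
rewrite -(push_mulx (@fst_circle_inj _ a b c)) ?circle_compsT //.
by rewrite circle_final -kappa0E.
Qed.

(** On the disjoint union of the two factors nu is the sum of its parts on either side, and it
    commutes with all saddles; this is the Leibniz rule. *)
Lemma hnu_hmul_bdelta S1 S2 : S1 \subset comps a b -> S2 \subset comps b c ->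
  hnu (hmul (bdelta (a, b, S1)) (bdelta (b, c, S2))) =
  hmul (hemb a b (nu_b R S1)) (bdelta (b, c, S2)) +
  hmul (bdelta (a, b, S1)) (hemb b c (nu_b R S2)).
Proof.
move=> s1 s2; have s12 := start_labels_sub s1 s2.
have sd : supported (compsT a b c set0) (delta R (start_labels S1 S2)) by apply: supported_delta.
rewrite hmul_bdelta // hnu_readout; last exact: supported_final.
rewrite -saddles_nu //; [|exact: arc_closed0|exact: arc_seq_arcs].
rewrite nu_delta nu_b_setU; last first.
  apply/pred0P => D /=; apply/negP => /andP[/imsetP[C CS ->] /imsetP[C' _ /eqP]].
  by apply/negP/copy_disjoint/(subsetP s1).
rewrite !linearD /=; congr (_ + _).
  rewrite hemb_nu_b -/(hmulr (bdelta (b, c, S2)) _) !linear_sum (big_imset _ (in2W (@copy_inj _ _))) /=.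
  apply: eq_bigr => k kS; have k1 := subset_trans (subsetDl S1 [set k]) s1.
  rewrite /hmulr (hmul_bdelta k1 s2).
  by rewrite /start_labels (imset_setD1 (A := setT) (in2W (@copy_inj _ _))).
rewrite hemb_nu_b !linear_sum (big_imset _ (in2W (@copy_inj _ _))) /=.
apply: eq_bigr => k kS; have k2 := subset_trans (subsetDl S2 [set k]) s2.
rewrite (hmul_bdelta s1 k2).
by rewrite /start_labels (imset_setD1 (A := setT) (in2W (@copy_inj _ _))).
Qed.

Lemma hX_hmul_bdelta_l S1 S2 : S1 \subset comps a b -> S2 \subset comps b c ->
  hX (hmul (bdelta (a, b, S1)) (bdelta (b, c, S2))) =
  hmul (hemb a b (mulx_b R (kappa0 a b) S1)) (bdelta (b, c, S2)).
Proof.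
move=> s1 s2; have s12 := start_labels_sub s1 s2.
have sd : supported (compsT a b c set0) (delta R (start_labels S1 S2)) by apply: supported_delta.
rewrite hmul_bdelta // (hX_readout false); last exact: supported_final.
rewrite -(saddled_arcs b) -saddles_mulx //; [|exact: arc_closed0|exact: arc_seq_arcs].
rewrite mulx_delta circle_start -kappa0E -/(hmulr (bdelta (b, c, S2)) _) /mulx_b.
rewrite in_setU (mem_imset _ _ (@copy_inj _ _)).
have -> : (copy false (kappa0 a b) \in copy true @: S2) = false.
  apply/imsetP => -[C' _ /eqP]; apply/negP/copy_disjoint/kappa0_comps.
rewrite orbF; case: ifP => kS; first by rewrite !linear0.
have k1 : kappa0 a b |: S1 \subset comps a b by rewrite subUset sub1set kappa0_comps.
rewrite hemb_delta /hmulr (hmul_bdelta k1 s2).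
by rewrite /start_labels imsetU1 setUA.
Qed.

Lemma hX_hmul_bdelta_r S1 S2 : S1 \subset comps a b -> S2 \subset comps b c ->
  hX (hmul (bdelta (a, b, S1)) (bdelta (b, c, S2))) =
  hmul (bdelta (a, b, S1)) (hemb b c (mulx_b R (kappa0 b c) S2)).
Proof.
move=> s1 s2; have s12 := start_labels_sub s1 s2.
have sd : supported (compsT a b c set0) (delta R (start_labels S1 S2)) by apply: supported_delta.
rewrite hmul_bdelta // (hX_readout true); last exact: supported_final.
rewrite -(saddled_arcs b) -saddles_mulx //; [|exact: arc_closed0|exact: arc_seq_arcs].
rewrite mulx_delta circle_start -kappa0E /mulx_b.
rewrite in_setU (mem_imset _ _ (@copy_inj _ _)).
have -> : (copy true (kappa0 b c) \in copy false @: S1) = false.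
  apply/imsetP => -[C' C'S /eqP]; rewrite eq_sym; apply/negP/copy_disjoint.
  exact: (subsetP s1).
rewrite /=; case: ifP => kS; first by rewrite !linear0.
have k2 : kappa0 b c |: S2 \subset comps b c by rewrite subUset sub1set kappa0_comps.
rewrite hemb_delta (hmul_bdelta s1 k2).
by rewrite /start_labels imsetU1 setUCA.
Qed.

End Product.

(** * The Leibniz rule and the linearity of X on all of H_n *)

Lemma hmul_hemb_neq a b b' c st st' : b != b' -> hmul (hemb a b st) (hemb b' c st') = 0.
Proof.
move=> nb; apply: (bilinear_eq (L := fun st st' => hmul (hemb a b st) (hemb b' c st'))
  (M := fun _ _ => 0)) => [w k x y|w k x y|_ k _ _|_ k _ _|S S'].
- by rewrite linearP bilin_linear_l.
- by rewrite linearP bilin_linear_r.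
- by rewrite scaler0 addr0.
- by rewrite scaler0 addr0.
rewrite !hemb_delta.
have [sS|/bdelta_invalid ->] := boolP (S \subset comps a b); last first.
  by rewrite -/(hmulr _ _) linear0.
have [sS'|/bdelta_invalid ->] := boolP (S' \subset comps b' c); last exact: linear0.
have [h1 e1 ->] := bdelta_valid sS; have [h2 e2 ->] := bdelta_valid sS'.
by rewrite bilin_delta mulb_neq ?e1 ?e2.
Qed.

Lemma hbilinear_eq (L M : H -> H -> H) :
  (forall v, linear (L^~ v)) -> (forall u, linear (L u)) ->
  (forall v, linear (M^~ v)) -> (forall u, linear (M u)) ->
  (forall a b b' c S S', S \subset comps a b -> S' \subset comps b' c ->
     L (bdelta (a, b, S)) (bdelta (b', c, S')) =
     M (bdelta (a, b, S)) (bdelta (b', c, S'))) ->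
  forall u v, L u v = M u v.
Proof.
move=> Ll Lr Ml Mr eqLM; apply: bilinear_eq => // h h'; rewrite -!bdelta_lab.
have := lab_valid h; have := lab_valid h'.
by case: (lab h) (lab h') => [[a b] S] [[b' c] S'] /= *; apply: eqLM.
Qed.

Lemma hnu_bdelta a b S : S \subset comps a b -> hnu (bdelta (a, b, S)) = hemb a b (nu_b R S).
Proof. by move=> sS; rewrite -hemb_delta hnu_hemb ?nu_delta //; apply: supported_delta. Qed.

Lemma hX_bdelta a b S : S \subset comps a b ->
  hX (bdelta (a, b, S)) = hemb a b (mulx_b R (kappa0 a b) S).
Proof. by move=> sS; rewrite -hemb_delta hX_hemb ?mulx_delta //; apply: supported_delta. Qed.

Lemma hnu_hmul u v : hnu (hmul u v) = hmul (hnu u) v + hmul u (hnu v).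
Proof.
apply: (hbilinear_eq (L := fun u v => hnu (hmul u v))
  (M := fun u v => hmul (hnu u) v + hmul u (hnu v))).
- by move=> w k x y /=; rewrite bilin_linear_l linearP.
- by move=> w k x y /=; rewrite bilin_linear_r linearP.
- by move=> w k x y /=; rewrite linearP !bilin_linear_l scalerDr addrACA.
- by move=> w k x y /=; rewrite !linearP scalerDr addrACA.
move=> a b b' c S S' sS sS'; rewrite !hnu_bdelta //.
have [eb|nb] := eqVneq b b'; first by subst b'; rewrite hnu_hmul_bdelta.
by rewrite -!hemb_delta !hmul_hemb_neq // addr0 linear0.
Qed.

Lemma hX_hmul_l u v : hX (hmul u v) = hmul (hX u) v.
Proof.
apply: (hbilinear_eq (L := fun u v => hX (hmul u v)) (M := fun u v => hmul (hX u) v)).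
- by move=> w k x y /=; rewrite bilin_linear_l linearP.
- by move=> w k x y /=; rewrite bilin_linear_r linearP.
- by move=> w k x y /=; rewrite linearP !bilin_linear_l.
- by move=> w k x y /=; rewrite !bilin_linear_r.
move=> a b b' c S S' sS sS'; rewrite !hX_bdelta //.
have [eb|nb] := eqVneq b b'; first by subst b'; rewrite hX_hmul_bdelta_l.
by rewrite -!hemb_delta !hmul_hemb_neq // linear0.
Qed.

Lemma hX_hmul_r u v : hX (hmul u v) = hmul u (hX v).
Proof.
apply: (hbilinear_eq (L := fun u v => hX (hmul u v)) (M := fun u v => hmul u (hX v))).
- by move=> w k x y /=; rewrite bilin_linear_l linearP.
- by move=> w k x y /=; rewrite bilin_linear_r linearP.
- by move=> w k x y /=; rewrite !bilin_linear_l.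
- by move=> w k x y /=; rewrite linearP !bilin_linear_r.
move=> a b b' c S S' sS sS'; rewrite !hX_bdelta //.
have [eb|nb] := eqVneq b b'; first by subst b'; rewrite hX_hmul_bdelta_r.
by rewrite -!hemb_delta !hmul_hemb_neq // linear0.
Qed.

(** * The reduced algebra and the map lambda *)

Local Notation marked_label h := (kappa0 (lab h).1.1 (lab h).1.2 \in (lab h).2).

Variables (B' : finType) (inc : B' -> B).
Local Notation Ht := {ffun B' -> R^o}.
Variables (rlift : Ht -> H) (pr : H -> Ht).
Hypotheses (inc_onto : forall h, ~~ marked_label h -> exists r, h = inc r)
  (inc_marked : forall r, ~~ marked_label (inc r))
  (rlift_inc : forall w r, rlift w (inc r) = w r)
  (rlift_marked : forall w h, marked_label h -> rlift w h = 0)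
  (prE : forall u r, pr u r = u (inc r)).

Lemma rlift_is_linear : linear rlift.
Proof.
move=> k w w'; apply/ffunP => h; rewrite !ffunE.
have [mh|/inc_onto[r ->]] := boolP (marked_label h); last by rewrite !rlift_inc !ffunE.
by rewrite !rlift_marked // scaler0 addr0.
Qed.

Lemma pr_is_linear : linear pr.
Proof. by move=> k u v; apply/ffunP => r; rewrite !(prE, ffunE). Qed.

HB.instance Definition _ := GRing.isLinear.Build R Ht H *:%R rlift rlift_is_linear.
HB.instance Definition _ := GRing.isLinear.Build R H Ht *:%R pr pr_is_linear.

Lemma pr_rlift w : pr (rlift w) = w.
Proof. by apply/ffunP => r; rewrite prE rlift_inc. Qed.

Lemma hX_marked h : marked_label h -> hX (delta R h) = 0.
Proof. by move=> mh; rewrite /hX lin_ext_delta mulx_b_in // linear0. Qed.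

(** Reduction forgets exactly the basis elements with marked circle labelled x, and X kills
    those. *)
Lemma hX_rlift_pr u : hX (rlift (pr u)) = hX u.
Proof.
apply: (lin_ext_eq (F := hX \o (rlift \o pr)) (G := hX)) => h.
have [mh|/inc_onto[r eh]] := boolP (marked_label h); rewrite /=.
  suff -> : pr (delta R h) = 0 by rewrite !linear0 hX_marked.
  apply/ffunP => r; rewrite prE !ffunE; case: eqP => // eh.
  by have := inc_marked r; rewrite eh mh.
congr (hX _); apply/ffunP => h'.
have [mh|/inc_onto[r' ->]] := boolP (marked_label h'); last by rewrite rlift_inc prE.
rewrite rlift_marked // ffunE; case: eqP => // e.
by have := inc_marked r; rewrite -eh -e mh.
Qed.

Lemma pr_hX u : pr (hX u) = 0.
Proof.
apply: (lin_ext_eq (F := pr \o hX) (G := \0)) => h /=; rewrite /hX lin_ext_delta.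
rewrite /mulx_b; case: ifP => _; first by rewrite !linear0.
rewrite hemb_delta; apply/ffunP => r; rewrite prE !ffunE; case: eqP => // e.
by have := inc_marked r; rewrite e setU11.
Qed.

Variable lamb : B' * bool -> H.
Hypothesis lambE : forall r s a b (Sx : {set {set P}}), lab (inc r) = (a, b, Sx) ->
  lamb (r, s) = if s then bdelta (a, b, kappa0 a b |: Sx)
    else bdelta (a, b, Sx) +
         \sum_(k in Sx) bdelta (a, b, kappa0 a b |: (Sx :\ k)).

Local Notation lam1 := (lift1 hnu hX rlift).
Local Notation lamx := (liftx hX rlift).

Lemma rlift_delta r : rlift (delta R r) = delta R (inc r).
Proof.
have inc_inj : injective inc.
  move=> r1 r2 e; apply/eqP; have := rlift_inc (delta R r2) r1.
  rewrite e rlift_inc !ffunE eqxx; case: eqP => // _ /eqP; rewrite oner_eq0 //.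
apply/ffunP => h; have [mh|/inc_onto[r' ->]] := boolP (marked_label h).
  rewrite rlift_marked // ffunE; case: eqP => // e.
  by have := inc_marked r; rewrite -e mh.
by rewrite rlift_inc !ffunE (inj_eq inc_inj).
Qed.

(** In nu of [kappa0 a b |: Sx], removing the marked circle gives the leading term of lambda(v (x)
    1), and removing [k] in [Sx] gives the correction at [k]. *)
Lemma lamb_lift r s :
  lamb (r, s) = if s then lamx (delta R r) else lam1 (delta R r).
Proof.
case e : (lab (inc r)) => [[a b] Sx]; rewrite (lambE s e) /lift1 /liftx /= rlift_delta.
have := inc_marked r; have := lab_valid (inc r); rewrite e /= => sS kS.
rewrite -bdelta_lab // e hX_bdelta // mulx_b_notin // hemb_delta.
case: s => //; rewrite hnu_bdelta //; last by rewrite subUset sub1set kappa0_comps.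
rewrite nu_b_setU1 // linearD linear_sum /= hemb_delta; congr (_ + _).
by apply: eq_bigr => k _; rewrite hemb_delta.
Qed.

Lemma lam_lift (u : {ffun B' * bool -> R^o}) :
  lin_ext lamb u = lam1 (slice false u) + lamx (slice true u).
Proof.
pose F := (hnu \o (hX \o (rlift \o slice false))) \+ (hX \o (rlift \o slice true)).
apply: (lin_ext_eq (F := lin_ext lamb) (G := F)) => -[r s].
rewrite /F /= lin_ext_delta lamb_lift !slice_delta.
by case: s; rewrite /= !linear0 ?add0r ?addr0.
Qed.

(** Mirrors [tprod_b], so that the two agree by conversion at the standard basis. *)
Definition tprod (p q : B' * bool) : {ffun B' * bool -> R^o} :=
  if p.2 && q.2 then 0 else
  let w := pr (hmul (rlift (delta R p.1)) (rlift (delta R q.1))) in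
  [ffun p' : B' * bool => if p'.2 == (p.2 || q.2) then w p'.1 else 0].

Local Notation lam := (lin_ext lamb).

Definition one : H := [ffun h => (((lab h).1.1 == (lab h).1.2) && ((lab h).2 == set0))%:R].

Lemma hnu_one : hnu one = 0.
Proof.
apply: big1 => h _; rewrite ffunE; case: eqP => [_|]; last by rewrite scale0r.
by case: eqP => [->|]; rewrite ?scale0r // /nu_b big_set0 linear0 scaler0.
Qed.

Lemma lam_one : lam [ffun p => (~~ p.2)%:R * pr one p.1] = one.
Proof.
rewrite lam_lift.
have -> : slice true [ffun p => (~~ p.2)%:R * pr one p.1] = 0.
  by apply/ffunP => r; rewrite !ffunE mul0r.
have -> : slice false [ffun p => (~~ p.2)%:R * pr one p.1] = pr one.
  by apply/ffunP => r; rewrite !ffunE mul1r.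
rewrite /liftx !linear0 addr0.
by apply: (lift1_pr hnu_hX hX_rlift_pr hnu_one).
Qed.

Lemma lam_bijective : bijective lam.
Proof.
(* The inverse is read off from u = nu X u + X nu u: the component along 1 is the reduction of [u],
   the one along x that of [hnu u]. *)
exists (fun u => unslice (pr u) (pr (hnu u))) => u; rewrite lam_lift.
  have p1 := pr_lift1 hnu_hX pr_rlift pr_hX.
  have p2 := pr_d_lift1 hnu_hnu hnu_hX pr_rlift pr_hX.
  by rewrite p1 p2 unslice_slice.
by rewrite !slice_unslice; apply: (lift1_pr_add hnu_hX hX_rlift_pr).
Qed.

Lemma lam_mul f g : lam (bilin_ext tprod f g) = hmul (lam f) (lam g).
Proof.
apply: (bilinear_eq (L := fun f g => lam (bilin_ext tprod f g))
  (M := fun f g => hmul (lam f) (lam g))) => [w k x y|w k x y|w k x y|w k x y|[r s] [r' s']].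
- by rewrite bilin_linear_l linearP.
- by rewrite bilin_linear_r linearP.
- by rewrite linearP bilin_linear_l.
- by rewrite !linearP.
have m0 w : hmul w 0 = 0 by apply: linear0.
rewrite bilin_delta !lin_ext_delta !lamb_lift /tprod /=.
set w := pr _.
have slw t t' : slice t [ffun p' : B' * bool => if p'.2 == t' then w p'.1 else 0] =
    if t == t' then w else 0.
  by apply/ffunP => q; rewrite !ffunE /=; case: eqP => _; rewrite ?ffunE.
(* The cases are x times x, x times 1, 1 times x and 1 times 1, in this order. *)
case: s s' => [] [] /=; rewrite ?lam_lift ?slw /=.
- by rewrite -lam_lift linear0 (liftx_mulx rlift hX_hX hX_hmul_l hX_hmul_r).
- rewrite !linear0 add0r.
  by apply: (liftx_mul hX_hX hnu_hX hX_rlift_pr hX_hmul_l hX_hmul_r).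
- rewrite !linear0 add0r.
  by apply: (lift1_mulx hX_hX hnu_hX hX_rlift_pr hX_hmul_l hX_hmul_r).
rewrite !linear0 addr0.
by apply: (lift1_mul hX_hX hnu_hnu hnu_hX hX_rlift_pr m0 hnu_hmul hX_hmul_l hX_hmul_r).
Qed.

End ArcAlgebra.

(** * The standard bases, degrees and the theorem *)

Section StandardBasis.
Variables (R : comNzRingType) (n : nat).

Definition hlab (h : hb n) : trip n := val h.

Lemma hlab_inj : injective hlab. Proof. exact: val_inj. Qed.

Lemma hlab_valid h : (hlab h).2 \subset comps (hlab h).1.1 (hlab h).1.2.
Proof. exact: valP h. Qed.

Lemma hlab_onto a b (S : {set {set pt n}}) : S \subset comps a b -> exists h, hlab h = (a, b, S).
Proof. by move=> sS; exists (exist _ (a, b, S) sS). Qed.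

Lemma rb_hb (r : rb n) : (val r).2 \subset comps (val r).1.1 (val r).1.2.
Proof. exact: subset_trans (valP r) (subsetDl _ _). Qed.

Definition rinc (r : rb n) : hb n := exist _ (val r) (rb_hb r).

Lemma rinc_onto h : kappa0 (hlab h).1.1 (hlab h).1.2 \notin (hlab h).2 -> exists r, h = rinc r.
Proof.
move=> kh; have rP : (val h).2 \subset comps (val h).1.1 (val h).1.2 :\ kappa0 (val h).1.1 (val h).1.2.
  by rewrite subsetD1 kh andbT; apply: valP h.
by exists (exist _ (val h) rP); apply: val_inj.
Qed.

Lemma rinc_unmarked r : kappa0 (hlab (rinc r)).1.1 (hlab (rinc r)).1.2 \notin (hlab (rinc r)).2.
Proof. by have := valP r; rewrite subsetD1 => /andP[]. Qed.

Lemma rcoefE (u : {ffun rb n -> R^o}) r : rcoef u (val r) = u r.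
Proof. by rewrite /rcoef valK. Qed.

Lemma rlift_rinc (u : {ffun rb n -> R^o}) r : rlift u (rinc r) = u r.
Proof. by rewrite ffunE rcoefE. Qed.

Lemma rlift_marked (u : {ffun rb n -> R^o}) h :
  kappa0 (hlab h).1.1 (hlab h).1.2 \in (hlab h).2 -> rlift u h = 0.
Proof.
move=> kh; rewrite ffunE /rcoef insubF //.
by rewrite subsetD1 kh andbF.
Qed.

Definition reduce (u : {ffun hb n -> R^o}) : {ffun rb n -> R^o} := [ffun r => hcoef u (val r)].

Lemma reduceE (u : {ffun hb n -> R^o}) r : reduce u r = u (rinc r).
Proof. by rewrite ffunE /hcoef (valK (rinc r)). Qed.

Lemma hprod_neq h1 h2 : (hlab h1).1.2 != (hlab h2).1.1 -> hprod_b R h1 h2 = 0.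
Proof.
rewrite /hprod_b /hlab; case: (val h1) (val h2) => [[a b] S1] [[b' c] S2] /= nb.
by rewrite nb.
Qed.

Lemma hprodE h1 h2 a b c S1 S2 : hlab h1 = (a, b, S1) -> hlab h2 = (b, c, S2) ->
    let S12 := [set [set ((v : pt n), false) | v in C] | C : {set pt n} in S1] :|:
               [set [set ((v : pt n), true) | v in C] | C : {set pt n} in S2] in
    hprod_b R h1 h2 = [ffun h => if (hlab h).1 == (a, c) then
      \sum_(Sf : {set {set pt n * bool}} |
          [set [set v.1 | v in D] | D : {set pt n * bool} in Sf] == (hlab h).2)
        saddles a b c set0 (arcs b) (delta R S12) Sf
      else 0].
Proof. by rewrite /hlab /hprod_b => -> -> /=; case: ifP => // /negP[]; apply/eqP. Qed.

Lemma lam_bE r s a b (Sx : {set {set pt n}}) : hlab (rinc r) = (a, b, Sx) ->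
  lam_b R (r, s) = if s then bdelta R hlab (a, b, kappa0 a b |: Sx)
    else bdelta R hlab (a, b, Sx) +
         \sum_(k in Sx) bdelta R hlab (a, b, kappa0 a b |: (Sx :\ k)).
Proof. by rewrite /lam_b /hlab /= => ->. Qed.

(** Moving an x from [k] to the marked circle keeps the number of labels x. The shift by -1 in
    [rdeg] cancels the degree of 1 in A, and together with the degree of x it accounts for one more
    label x. *)
Lemma lam_b_deg (p : tb n) (h : hb n) : (0 < n)%N -> lam_b R p h != 0 -> hdeg h = tdeg p.
Proof.
move=> n0; case: p => r s; rewrite /tdeg /rdeg /lam_b /hdeg.
have := rinc_unmarked r; rewrite /hlab /=; case e: (val r) => [[a b] Sx] /= kS.
have hd S : hdelta R (a, b, S) h != 0 -> val h = (a, b, S).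
  by rewrite ffunE; have [//|_] := eqVneq (val h) (a, b, S); rewrite eqxx.
case: s => /=.
  by move=> /hd -> /=; rewrite cardsU1 kS; move: #|comps a b| #|Sx| => x y; lia.
rewrite ffunE; have [-> |/hd -> _ /=] := eqVneq (hdelta R (a, b, Sx) h) 0; last first.
  by move: #|comps a b| #|Sx| => x y; lia.
rewrite add0r sum_ffunE => nz.
have [k kSx /hd ->] : exists2 k, k \in Sx & hdelta R (a, b, kappa0 a b |: Sx :\ k) h != 0.
  apply/exists_inP; apply: contraNT nz; rewrite negb_exists_in => /forall_inP z.
  by apply/eqP/big1 => k /z; rewrite negbK => /eqP.
rewrite /= cardsU1 !inE (negPf kS) andbF (cardsD1 k Sx) kSx.
by move: #|comps a b| #|Sx :\ k| => x y; lia.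
Qed.

End StandardBasis.

Theorem theorem3p1 (R : comNzRingType) (n : nat) :
  2%N \in [pchar R] -> (0 < n)%N ->
  [/\ linear (@lam R n),
      bijective (@lam R n),
      (forall u v : {ffun tb n -> R^o},
          lam (tmul u v) = hmul (lam u) (lam v)),
      lam (@tone R n) = @hone R n
    & (forall (p : tb n) (h : hb n), @lam_b R n p h != 0 -> hdeg h = tdeg p)].
Proof.
move=> char2 n_gt0; split.
- exact: lin_ext_is_linear.
- apply: (lam_bijective (@hlab_inj n) (@hlab_valid n) (@hlab_onto n) n_gt0 char2
    (@rinc_onto n) (@rinc_unmarked n) (@rlift_rinc R n) (@rlift_marked R n) (@reduceE R n)
    (@lam_bE R n)).
- move=> u v.
  apply: (lam_mul (@hlab_inj n) (@hlab_valid n) (@hlab_onto n) (@hprod_neq R n) (@hprodE R n)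
    n_gt0 char2
    (@rinc_onto n) (@rinc_unmarked n) (@rlift_rinc R n) (@rlift_marked R n) (@reduceE R n)
    (@lam_bE R n)).
(* The unit of the reduced algebra is the reduction of the unit of H_n. *)
- have -> : tone R n = [ffun p => (~~ p.2)%:R * reduce (hone R n) p.1].
    by apply/ffunP => p; rewrite [LHS]ffunE [RHS]ffunE reduceE; congr (_ * _); rewrite !ffunE.
  apply: (lam_one (@hlab_inj n) (@hlab_valid n) (@hlab_onto n) n_gt0 char2
    (@rinc_onto n) (@rinc_unmarked n) (@rlift_rinc R n) (@rlift_marked R n) (@reduceE R n)
    (@lam_bE R n)).
by move=> p h; apply: lam_b_deg.
Qed.
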